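(* Suppose $E$ and $F$ are directed graphs with finitely many vertices and no sinks. Then any homeomorphism between $\partial E$ and $\partial F$ and any homeomorphism between $\partial SE$ and $\partial SF$ preserves isolated eventually periodic points. Thus, $\mathcal{G}_E$ and $\mathcal{G}_F$ are isomorphic if and only if $E$ and $F$ are orbit equivalent, and $\mathcal{G}_{SE}$ and $\mathcal{G}_{SF}$ are isomorphic if and only if $SE$ and $SF$ are orbit equivalent.
   Context: $\mathbb{N}$ denotes the nonnegative integers (so $0\in\mathbb{N}$). **Graphs and paths.** A directed graph $E=(E^0,E^1,r,s)$ consists of countable sets $E^0$ (vertices), $E^1$ (edges) and functions $r,s:E^1\to E^0$ (range and source). A path of length $n\ge 1$ is a sequence $\mu=\mu_1\cdots\mu_n$ of edges with $r(\mu_i)=s(\mu_{i+1})$ for $1\le i\le n-1$; $s(\mu):=s(\mu_1)$, $r(\mu):=r(\mu_n)$, $|\mu|=n$. Vertices are paths of length $0$ with $s(v)=r(v)=v$. $E^n$ is the set of paths of length $n$, $E^*=\bigcup_{n\in\mathbb{N}}E^n$, and $E^\infty$ is the set of infinite paths $x=x_1x_2\cdots$ ($x_i\in E^1$, $r(x_i)=s(x_{i+1})$), with $s(x)=s(x_1)$ and $|x|=\infty$. For a vertex $v$, $vE^1=\{e\in E^1:s(e)=v\}$. A vertex $v$ is a sink if $vE^1=\emptyset$ and an infinite emitter if $vE^1$ is infinite; $E^0_{\mathrm{sing}}$ is the set of sinks and infinite emitters. **Stabilisation.** $SE$ is the directed graph obtained from $E$ by attaching a head to every vertex: for each $v\in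 E^0$ one adds new vertices $v_1,v_2,v_3,\dots$ and new edges $e^v_1,e^v_2,\dots$ with $r(e^v_1)=v$, $s(e^v_i)=v_i$ for $i\ge1$, and $r(e^v_{i})=v_{i-1}$ for $i\ge2$ (i.e. $\cdots\to v_3\to v_2\to v_1\to v$), all added vertices and edges being distinct for distinct $v$. **Boundary path space.** $\partial E:=E^\infty\cup\{\mu\in E^*:r(\mu)\in E^0_{\mathrm{sing}}\}$. For $\mu\in E^*$, $Z(\mu):=\{\mu x\in\partial E: x\in\partial E,\ s(x)=r(\mu)\}$ (concatenation, with $\mu x=x$ if $\mu$ is a vertex, and $\mu x=\mu$ if $x=r(\mu)$ is a vertex), and for a finite set $F\subseteq r(\mu)E^1$, $Z(\mu\setminus F):=Z(\mu)\setminus\bigcup_{e\in F}Z(\mu e)$. The sets $Z(\mu\setminus F)$ are a basis for a locally compact Hausdorff topology on $\partial E$, and each is compact and open. **Shift.** For $n\in\mathbb{N}$, $\partial E^{\ge n}:=\{x\in\partial E:|x|\ge n\}$, an open subset. The shift map $\sigma_E:\partial E^{\ge1}\to\partial E$ is $\sigma_E(x_1x_2x_3\cdots)=x_2x_3\cdots$ for $x_1x_2x_3\cdots\in\partial E^{\ge2}$ and $\sigma_E(e)=r(e)$ for $e\in\partial E\cap E^1$. $\sigma_E^n$ is the $n$-fold composition, $\sigma_E^0=\mathrm{id}$; writing $\sigma_E^n(x)$ implicitly asserts $x\in\partial E^{\ge n}$. An infinite path $x\in E^\infty$ is eventually periodic if there are $n,p\in\mathbb{N}$ with $p>0$ and $\sigma_E^{n+p}(x)=\sigma_E^n(x)$.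 An isolated eventually periodic point of $\partial E$ is an eventually periodic infinite path $x$ such that $\{x\}$ is open in $\partial E$. **Orbit equivalence.** A homeomorphism $h:\partial E\to\partial F$ is an orbit equivalence if there are continuous functions $k,l:\partial E^{\ge1}\to\mathbb{N}$ and $k',l':\partial F^{\ge1}\to\mathbb{N}$ such that $\sigma_F^{k(x)}(h(\sigma_E(x)))=\sigma_F^{l(x)}(h(x))$ for all $x\in\partial E^{\ge1}$ and $\sigma_E^{k'(y)}(h^{-1}(\sigma_F(y)))=\sigma_E^{l'(y)}(h^{-1}(y))$ for all $y\in\partial F^{\ge1}$. $E$ and $F$ are orbit equivalent if there is an orbit equivalence $h:\partial E\to\partial F$. A homeomorphism $h:\partial E\to\partial F$ preserves isolated eventually periodic points if it maps the set of isolated eventually periodic points of $\partial E$ onto the set of isolated eventually periodic points of $\partial F$. **Graph groupoid.** $\mathcal{G}_E=\{(x,m-n,y):x,y\in\partial E,\ m,n\in\mathbb{N},\ \sigma_E^m(x)=\sigma_E^n(y)\}$, with product $(x,k,y)(w,l,z)=(x,k+l,z)$ if $y=w$ (undefined otherwise) and inverse $(x,k,y)^{-1}=(y,-k,x)$. Its topology is generated by the sets $Z(U,m,n,V):=\{(x,k,y)\in\mathcal{G}_E:x\in U,\ k=m-n,\ y\in V,\ \sigma_E^m(x)=\sigma_E^n(y)\}$, where $m,n\in\mathbb{N}$, $U\subseteq\partial E^{\ge m}$ is open with $\sigma_E^m|_U$ injective, $V\subseteq\partial E^{\ge n}$ is open with $\sigma_E^n|_V$ injective, and $\sigma_E^m(U)=\sigma_E^n(V)$.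 An isomorphism of groupoids is a groupoid isomorphism that is also a homeomorphism. *)

(* Defs.v *)
From HB Require Import structures.
From mathcomp Require Import all_boot all_order all_algebra.
From mathcomp Require Import boolp classical_sets functions cardinality.
From mathcomp Require Import topology.
From mathcomp Require Import zify.

Set Implicit Arguments.
Unset Strict Implicit.
Unset Printing Implicit Defensive.

Import Order.TTheory GRing.Theory.
Local Open Scope classical_set_scope.
Local Open Scope nat_scope.

Record digraph := Digraph {
  vert : countType;
  edge : countType;
  src : edge -> vert;
  rng : edge -> vert }.

Section Graphs.
Variable E : digraph.

Definition out_edges (v : vert E) : set (edge E) := [set e | src e = v].
Definition sink (v : vert E) : Prop := out_edges v = set0.
Definition infinite_emitter (v : vert E) : Prop := infinite_set (out_edges v).
Definition singular (v : vert E) : Prop := sink v \/ infinite_emitter v.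

(* A finite path is given by its source vertex and its sequence of edges, so
   that the empty sequence at v is the vertex v seen as a path of length 0. *)
Fixpoint is_path (v : vert E) (s : seq (edge E)) : Prop :=
  if s is e :: s' then src e = v /\ is_path (rng e) s' else True.

Definition path_rng (v : vert E) (s : seq (edge E)) : vert E :=
  last v (map (@rng E) s).

Inductive prepath : Type :=
| Fin of vert E & seq (edge E)
| Inf of nat -> edge E.

Definition prepath_src (p : prepath) : vert E :=
  match p with Fin v _ => v | Inf x => src (x 0) end.

Definition is_boundary (p : prepath) : Prop :=
  match p with
  | Fin v s => is_path v s /\ singular (path_rng v s)
  | Inf x => forall i, rng (x i) = src (x i.+1)
  end.

(* In the infinite case the i-th edge of the result is the i-th edge of s if
   i < size s, and x (i - size s) otherwise. *)
Definition prepath_cat (v : vert E) (s : seq (edge E)) (p : prepath) :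
    prepath :=
  match p with
  | Fin _ t => Fin v (s ++ t)
  | Inf x => Inf (fun i => nth (x (i - size s)) s i)
  end.

(* Paths of length 0 are sent to themselves; the shift is only meant to be
   applied to paths of length at least 1. *)
Definition prepath_shift (p : prepath) : prepath :=
  match p with
  | Fin v [::] => Fin v [::]
  | Fin _ (e :: s) => Fin (rng e) s
  | Inf x => Inf (fun i => x i.+1)
  end.

Record bpath := BPath {
  bpath_val :> prepath;
  bpathP : is_boundary bpath_val }.

Lemma bpath_inj (x y : bpath) : bpath_val x = bpath_val y -> x = y.
Proof.
case: x y => [x px] [y py] /= xy; case: _ / xy py => py.
by congr BPath; exact: Prop_irrelevance.
Qed.

HB.instance Definition _ := gen_eqMixin bpath.
HB.instance Definition _ := gen_choiceMixin bpath.

Definition bpath_ge (n : nat) : set bpath :=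
  [set x | match bpath_val x with Fin _ s => n <= size s | Inf _ => True end].

Lemma shift_subproof (x : bpath) : is_boundary (prepath_shift x).
Proof. by case: x => -[v [|e s]|x] //= [] [? ?]. Qed.

Definition shift (x : bpath) : bpath := BPath (shift_subproof x).

(* sigma^m(x) = sigma^n(y), including the assertion that both sides are
   defined. *)
Definition shift_eq (m : nat) (x : bpath) (n : nat)
    (y : bpath) : Prop :=
  [/\ bpath_ge m x, bpath_ge n y & iter m shift x = iter n shift y].

Definition cylinder (v : vert E) (s : seq (edge E)) : set bpath :=
  [set y | exists x : bpath, prepath_src x = path_rng v s /\
                             bpath_val y = prepath_cat v s x].

Definition cylinder_diff (v : vert E) (s : seq (edge E))
    (F : set (edge E)) : set bpath :=
  cylinder v s `\` \bigcup_(e in F) cylinder v (rcons s e).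

Definition cylinder_basis : set (set bpath) :=
  [set A | exists v s F, [/\ is_path v s, finite_set F,
    F `<=` out_edges (path_rng v s) & A = cylinder_diff v s F]].

Definition prepath_onth (p : prepath) (i : nat) : option (edge E) :=
  match p with Fin _ s => onth s i | Inf x => Some (x i) end.

Lemma is_path_cat v s t :
  is_path v (s ++ t) <-> is_path v s /\ is_path (path_rng v s) t.
Proof.
elim: s v => [|e s IH] v /=; first by split=> [|[]].
by rewrite IH /path_rng /=; split=> [[? []]|[[]]].
Qed.

Lemma path_rng_cat v s t :
  path_rng v (s ++ t) = path_rng (path_rng v s) t.
Proof. by rewrite /path_rng map_cat last_cat. Qed.

Lemma cylinder_onth v s (x : bpath) i : cylinder v s x -> i < size s ->
  prepath_onth x i = onth s i.
Proof.
move=> [y [_ ->]] lt_is; case: (bpath_val y) => [w t|z] /=.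
  by rewrite onth_cat lt_is.
by rewrite onthE (nth_map (z (i - size s))).
Qed.

Lemma cylinder_prefix v s w t (x : bpath) : size s <= size t ->
  is_path v s -> is_path w t -> cylinder v s x -> cylinder w t x ->
  v = w /\ exists u, t = s ++ u.
Proof.
have cylinder_src a r : is_path a r -> cylinder a r x -> prepath_src x = a.
  move=> pr [y [yr ->]]; case: (bpath_val y) yr => [b r'|z] //= yr.
  by case: r pr yr => [|e r] //= [].
move=> le_st ps pt xs xt; split.
  by rewrite -(cylinder_src _ _ ps xs) (cylinder_src _ _ pt xt).
exists (drop (size s) t); rewrite -[LHS](cat_take_drop (size s)).
congr (_ ++ _); apply: eq_from_onth => i.
have [lt_is|le_si] := ltnP i (size s); last first.
  by rewrite !onth_default // size_takel.
rewrite -(cylinder_onth xs lt_is) (cylinder_onth xt (leq_trans lt_is le_st)).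
by rewrite -[in RHS](cat_take_drop (size s) t) onth_cat size_takel // lt_is.
Qed.

Lemma cylinder_cat v s t : is_path v (s ++ t) ->
  cylinder v (s ++ t) `<=` cylinder v s.
Proof.
move=> /is_path_cat[_ pt] x [y [ysrc xE]].
have yP : is_boundary (prepath_cat (path_rng v s) t y).
  move: ysrc; rewrite path_rng_cat; case: y {xE} => -[w u|z] /=.
    move=> [pu sing_u] wE; rewrite is_path_cat path_rng_cat -wE.
    by split=> //; split.
  move=> zP; elim: t (path_rng v s) pt => [|e t IH] w /=.
    by move=> _ _ i; rewrite !nth_nil !subn0.
  move=> [_ pt] zE i; have := IH _ pt zE.
  case: i => [|i] IHi; last by have := IHi i; rewrite !subSS.
  case: t pt zE {IH IHi} => [|f t] /= => [_|[-> //]].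
  by move=> zE; rewrite subnn zE.
exists (BPath yP); split=> /=.
  move: ysrc; rewrite path_rng_cat; case: (bpath_val y) => [w u|z] //=.
  by case: t pt {xE yP} => [|e t] /=; [|case].
rewrite xE /=; case: (bpath_val y) => [w u|z] /=; first by rewrite catA.
congr Inf; apply: funext => i; rewrite nth_cat size_cat subnDA.
have [lt_is|le_si] := ltnP i (size s); first exact: set_nth_default.
by rewrite [RHS]nth_default.
Qed.

Lemma cylinder_basis_cover : \bigcup_(A in cylinder_basis) A = setT.
Proof.
apply/seteqP; split=> // x _.
exists (cylinder_diff (prepath_src x) [::] set0).
  by exists (prepath_src x), [::], set0; split=> //; exact: finite_set0.
split; last by case.
exists x; split=> //=; case: (bpath_val x) => //= z.
by congr Inf; apply: funext => i; rewrite nth_nil subn0.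
Qed.

Lemma cylinder_basis_join A B x :
  cylinder_basis A -> cylinder_basis B -> A x -> B x ->
  exists C, [/\ cylinder_basis C, C x & C `<=` A `&` B].
Proof.
move=> [v [s [F [ps finF sF ->]]]] [w [t [G [pt finG sG ->]]]].
wlog le_st : v s F ps finF sF w t G pt finG sG / size s <= size t.
  move=> IH xA xB; have [le_st|/ltnW le_ts] := leqP (size s) (size t).
    exact: IH xA xB.
  by rewrite setIC; apply: IH xB xA.
move=> [xs xF] [xt xG].
have [vw [u tE]] := cylinder_prefix le_st ps pt xs xt; subst w t.
case: u => [|e u] in le_st pt sG xt xG *.
  rewrite cats0 in pt sG xt xG *.
  exists (cylinder_diff v s (F `|` G)); split.
  - exists v, s, (F `|` G); split=> //; first by rewrite finite_setU.
    by move=> e [/sF|/sG].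
  - by split=> // -[e [Fe|Ge] xe]; [apply: xF|apply: xG]; exists e.
  - by move=> y [ys yFG]; split; split=> // -[e eFG ye]; apply: yFG; exists e;
      auto; [left|right].
exists (cylinder_diff v (s ++ e :: u) G); split=> //.
  by exists v, (s ++ e :: u), G.
move=> y [yt yG]; split=> //; split; first exact: cylinder_cat yt.
move=> [f Ff yf]; apply: xF; exists f => //.
have cat_rcons' : s ++ e :: u = rcons s e ++ u by rewrite cat_rcons.
suff -> : f = e by rewrite cat_rcons' in pt xt; exact: cylinder_cat xt.
have lt_f : size s < size (rcons s f) by rewrite size_rcons.
have lt_e : size s < size (s ++ e :: u).
  by rewrite size_cat /= addnS ltnS leq_addr.
have := cylinder_onth yf lt_f; rewrite (cylinder_onth yt lt_e).
by rewrite -cats1 !onth_cat ltnn subnn /= => -[->].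
Qed.

HB.instance Definition _ := @isBaseTopological.Build bpath (set bpath)
  cylinder_basis id cylinder_basis_cover cylinder_basis_join.

Definition eventually_periodic (x : bpath) : Prop :=
  (exists z, bpath_val x = Inf z) /\
  exists n p, 0 < p /\ shift_eq (n + p) x n x.

Definition isolated_eventually_periodic : set bpath :=
  [set x | eventually_periodic x /\ open [set x]].

Record arrow := Arrow {
  arrow_l : bpath;
  arrow_int : int;
  arrow_r : bpath;
  arrowP : exists m n, arrow_int = (m%:Z - n%:Z)%R /\
                           shift_eq m arrow_l n arrow_r }.

HB.instance Definition _ := gen_eqMixin arrow.
HB.instance Definition _ := gen_choiceMixin arrow.

Definition composable (a b : arrow) : Prop := arrow_r a = arrow_l b.

Lemma bpath_ge_shift m n (x : bpath) : bpath_ge n x ->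
  bpath_ge m (iter n shift x) <-> bpath_ge (m + n) x.
Proof.
have ge1 j (y : bpath) : bpath_ge 1 y ->
    bpath_ge j (shift y) <-> bpath_ge j.+1 y.
  by case: y => -[v [|e s]|z].
elim: n x => [|n IH] x; first by rewrite addn0.
move=> le_n; have le_1 : bpath_ge 1 x.
  by case: x le_n => -[v s|z] xP //= le_n; exact: leq_trans le_n.
rewrite iterSr addnS -ge1 //; apply: IH; exact/(ge1 n x le_1).
Qed.

Lemma shift_eqD j m n x y : shift_eq m x n y -> bpath_ge (j + n) y ->
  shift_eq (j + m) x (j + n) y.
Proof.
move=> [xm yn xy] yj; split=> //; last by rewrite !iterD xy.
by apply/(bpath_ge_shift j xm); rewrite xy; apply/(bpath_ge_shift j yn).
Qed.

Lemma shift_eq_sym m n x y : shift_eq m x n y -> shift_eq n y m x.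
Proof. by case. Qed.

Local Open Scope ring_scope.

Lemma arrow_mul_subproof (a b : arrow) : composable a b ->
  exists m n, arrow_int a + arrow_int b = m%:Z - n%:Z /\
              shift_eq m (arrow_l a) n (arrow_r b).
Proof.
case: a b => [x k y [m [n [kE xy]]]] [y' l z [p [q [lE yz]]]].
rewrite /composable /= => yy'; subst k l y'.
have [_ yn _] := xy; have [yp _ _] := yz.
have [i [j [ij yij]]] : exists i j : nat,
    (i + n = j + p)%N /\ bpath_ge (i + n) y.
  have [le_np|/ltnW le_pn] := leqP n p.
    by exists (p - n)%N, 0%N; rewrite subnK.
  by exists 0%N, (n - p)%N; rewrite subnK.
have [xim _ xyE] := shift_eqD xy yij.
rewrite ij in yij xyE.
have [zjq _ zyE] := shift_eqD (shift_eq_sym yz) yij.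
exists (i + m)%N, (j + q)%N; split; first by lia.
by split=> //; rewrite xyE zyE.
Qed.

Definition arrow_mul (a b : arrow) (ab : composable a b) : arrow :=
  Arrow (arrow_mul_subproof ab).

Lemma arrow_inv_subproof (a : arrow) :
  exists m n, - arrow_int a = m%:Z - n%:Z /\
              shift_eq m (arrow_r a) n (arrow_l a).
Proof.
case: a => [x k y [m [n [kE xy]]]] /=; exists n, m.
by split; [rewrite kE opprB|exact: shift_eq_sym].
Qed.

Definition arrow_inv (a : arrow) : arrow := Arrow (arrow_inv_subproof a).

Definition arrow_set (U : set bpath) (m n : nat) (V : set bpath) :
    set arrow :=
  [set a | [/\ U (arrow_l a), arrow_int a = m%:Z - n%:Z, V (arrow_r a) &
               shift_eq m (arrow_l a) n (arrow_r a)]].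

Definition shift_injective_open (m : nat) (U : set bpath) : Prop :=
  [/\ U `<=` bpath_ge m, open U & set_inj U (iter m shift)].

Definition arrow_subbasis : set (set arrow) :=
  [set A | exists U m n V, [/\ shift_injective_open m U,
     shift_injective_open n V, iter m shift @` U = iter n shift @` V &
     A = arrow_set U m n V]].

HB.instance Definition _ :=
  @isSubBaseTopological.Build arrow (set arrow) arrow_subbasis id.

End Graphs.

Record homeo (X Y : topologicalType) := Homeo {
  homeo_fun :> X -> Y;
  homeo_inv : Y -> X;
  homeo_funK : cancel homeo_fun homeo_inv;
  homeo_invK : cancel homeo_inv homeo_fun;
  homeo_continuous : continuous homeo_fun;
  homeo_inv_continuous : continuous homeo_inv }.

Section Equivalences.
Variables E F : digraph.

Definition preserves_isolated_eventually_periodic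
    (h : homeo (bpath E) (bpath F)) : Prop :=
  h @` @isolated_eventually_periodic E = @isolated_eventually_periodic F.

(* k and l are only relevant on paths of length at least 1; continuity is with
   respect to the subspace topology there and the discrete topology on nat. *)
Definition orbit_cocycles (h : bpath E -> bpath F) (k l : bpath E -> nat) :
    Prop :=
  [/\ {within @bpath_ge E 1, continuous k},
      {within @bpath_ge E 1, continuous l} &
      forall x, bpath_ge 1 x ->
        shift_eq (k x) (h (shift x)) (l x) (h x)].

Definition groupoid_morphism (f : arrow E -> arrow F) : Prop :=
  (forall a b (ab : composable a b), exists fab : composable (f a) (f b),
     f (arrow_mul ab) = arrow_mul fab) /\
  (forall a, f (arrow_inv a) = arrow_inv (f a)).

End Equivalences.

Definition is_orbit_equivalence (E F : digraph)
    (h : homeo (bpath E) (bpath F)) : Prop :=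
  (exists k l, orbit_cocycles h k l) /\
  (exists k' l', orbit_cocycles (homeo_inv h) k' l').

Definition orbit_equivalent (E F : digraph) : Prop :=
  exists h : homeo (bpath E) (bpath F), is_orbit_equivalence h.

Definition groupoids_isomorphic (E F : digraph) : Prop :=
  exists f : homeo (arrow E) (arrow F),
    groupoid_morphism f /\ groupoid_morphism (homeo_inv f).

(* The vertex (v, 0) is v itself and, for i > 0, (v, i) is the i-th vertex v_i
   of the head attached to v; the edge inr (v, i) is e^v_(i+1). *)
Definition stabilisation (E : digraph) : digraph :=
  @Digraph (vert E * nat)%type (edge E + vert E * nat)%type
    (fun e => match e with
              | inl f => (src f, 0%N)
              | inr (v, i) => (v, i.+1)
              end)
    (fun e => match e with
              | inl f => (rng f, 0%N)
              | inr (v, i) => (v, i)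
              end).

Definition finitely_many_vertices (E : digraph) : Prop :=
  finite_set [set: vert E].

Definition no_sinks (E : digraph) : Prop := forall v : vert E, ~ sink v.

(* Main.v *)
Require Import Defs.
From mathcomp Require Import all_boot all_order all_algebra.
From mathcomp Require Import boolp classical_sets functions cardinality topology.
From mathcomp Require Import zify.

(** In a graph without sinks in which every infinite path keeps returning to
    vertices it has visited, an isolated boundary path is infinite, and from some
    vertex on nothing can branch off from it; two later visits to one vertex
    then have the same future, and the path is eventually periodic
    (isolated_eventually_periodicE). So the isolated eventually periodic points
    are the isolated points, which every homeomorphism preserves. Graphs with
    finitely many vertices have this recurrence property, and so do their
    stabilisations, whose infinite paths run down a head into the original
    graph.

    It remains to prove, for arbitrary graphs, that isomorphism of groupoids
    gives an orbit equivalence, and that an orbit equivalence preserving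
    isolated eventually periodic points gives an isomorphism.

    From an isomorphism one gets a homeomorphism of the unit spaces, and the
    image of the arrow from [x] to its shift yields the two cocycles; the
    countable clopen basis turns the locally constant exponents into continuous
    functions (groupoids_isomorphic_orbit_equivalent).

    Conversely let [h] be an orbit equivalence with cocycles [k] and [l]. Summing
    [l - k] along shifts gives an integer cocycle on the groupoid, and with it a
    continuous morphism sending [(x, n, y)] to [(h x, c, h y)]
    (arrow_push_morphism, arrow_push_continuous). It is bijective as soon as it is
    bijective on isotropy groups. At a point which is not isolated and
    eventually periodic this is automatic: following the morphism by the one
    built from the inverse of [h] changes integers by a locally constant amount,
    and a nonzero amount would make nearby points satisfy a common periodicity,
    which forces the point to be isolated and eventually periodic
    (isolated_isotropy, csum_arrow_pushK). At the isolated eventually periodic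
    points the cocycle can be wrong, but it can be repaired: on each orbit there
    is a periodic point on a cycle without exits, and changing the cocycle at
    that one point makes generators of isotropy groups go to generators
    (corrected_cocycle). The points so changed do not accumulate anywhere, hence
    the repaired cocycle is continuous. Finally the inverse of the bijective
    morphism is continuous because the left end of an arrow is a local
    homeomorphism (push_inv_continuous). *)

Set Implicit Arguments.
Unset Strict Implicit.
Unset Printing Implicit Defensive.

Import GRing.Theory.
Local Open Scope classical_set_scope.
Local Open Scope nat_scope.

(** * Boundary paths and their cylinders *)

Arguments shift {E} x.

Section BoundaryPaths.
Variable E : digraph.
Implicit Types (x y z : bpath E) (v : vert E) (s : seq (edge E)) (e : edge E).

Definition initial (n : nat) (p : prepath E) : seq (edge E) :=
  match p with Fin _ s => take n s | Inf z => mkseq z n end.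

(** A boundary path is finite exactly when some entry of it is undefined, so
    its source and its partial sequence of edges determine it. *)
Lemma bpath_ext x y : prepath_src x = prepath_src y ->
  (forall i, prepath_onth x i = prepath_onth y i) -> x = y.
Proof.
move=> sxy oxy; apply: bpath_inj.
case: x y sxy oxy => -[v s|z] xP [[w t|u] yP] /= sxy oxy.
- by rewrite sxy; congr Fin; apply: eq_from_onth.
- by have := oxy (size s); rewrite onth_default.
- by have := oxy (size t); rewrite onth_default.
- by congr Inf; apply: funext => i; have [] := oxy i.
Qed.

Lemma src_head x e : prepath_onth x 0 = Some e -> prepath_src x = src e.
Proof.
case: x => -[v [|f s]|z] xP //= [<-] //.
by case: xP => [[<- _] _].
Qed.

Lemma src_shift x e : prepath_onth x 0 = Some e -> prepath_src (shift x) = rng e.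
Proof. by case: x => -[v [|f s]|z] xP //= [<-] //; rewrite -xP. Qed.

Lemma onth_shift x i : prepath_onth (shift x) i = prepath_onth x i.+1.
Proof. by case: x => -[v [|f s]|z] xP /=; rewrite ?onth0n. Qed.

Lemma onth_iter_shift n x i :
  prepath_onth (iter n shift x) i = prepath_onth x (n + i).
Proof. by elim: n x i => [|n IH] x i //=; rewrite onth_shift IH addnS. Qed.

Lemma initial0 x : initial 0 x = [::].
Proof. by case: x => -[v s|z] ? //=; rewrite take0. Qed.

Lemma initialS x e n : prepath_onth x 0 = Some e ->
  initial n.+1 x = e :: initial n (shift x).
Proof.
case: x => -[v [|f s]|z] xP //= [<-] //.
by rewrite /mkseq /= -[1]/(1 + 0) iotaDl -map_comp.
Qed.

Lemma onth_take_lt s i n : i < n -> onth (take n s) i = onth s i.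
Proof. by elim: s n i => [|a s IH] [|n] [|i] //=; rewrite ltnS; apply: IH. Qed.

Lemma onth_initial x i n : i < n -> onth (initial n x) i = prepath_onth x i.
Proof.
case: x => -[v s|z] xP /= lt_in; first exact: onth_take_lt.
by rewrite onth_map -[n](subnKC lt_in) iotaD onth_cat size_iota ltnSn onthE
  (nth_map 0) ?size_iota ?nth_iota.
Qed.

Lemma eq_initial x y n :
  (forall i, i < n -> prepath_onth x i = prepath_onth y i) ->
  initial n x = initial n y.
Proof.
move=> xy; apply: eq_from_onth => i.
have sz z : size (initial n z) <= n.
  by case: z => -[v s|z] ? /=; rewrite ?size_mkseq // size_take; case: ltnP.
have [lt_in|le_ni] := ltnP i n; first by rewrite !onth_initial ?xy.
by rewrite !onth_default ?(leq_trans (sz _)).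
Qed.

Lemma bpath_ge1P x : bpath_ge 1 x <-> exists e, prepath_onth x 0 = Some e.
Proof.
by case: x => -[v [|f s]|z] xP; split=> //= ; try (by case); move=> _; eexists.
Qed.

Lemma bpath_geP n x :
  bpath_ge n x <-> forall i, i < n -> exists e, prepath_onth x i = Some e.
Proof.
case: x => -[v s|z] xP; rewrite /bpath_ge /=; last by split=> // _ i _; eexists.
split=> [le_n i lt_in|ex]; last first.
  case: leqP => // lt_sn; have [e] := ex _ lt_sn.
  by rewrite onth_default.
have := onthTE s i; rewrite (leq_trans lt_in le_n).
by case: onth => // e _; exists e.
Qed.


(** Membership in a cylinder is a comparison of source and first edges: the
    tail whose existence a cylinder asserts is recovered as a shift. *)
Lemma cylinderP v s x : is_path v s ->
  cylinder v s x <-> prepath_src x = v /\ initial (size s) x = s.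
Proof.
move=> ps; split.
  move=> [y [ysrc xE]]; split.
    rewrite xE; case: (bpath_val y) ysrc => [w t|z] //= ysrc.
    by case: s ps ysrc {xE} => [|e s] //= [].
  apply: eq_from_onth => i; have [lt_is|le_si] := ltnP i (size s).
    rewrite onth_initial // xE; case: (bpath_val y) => [w t|z] /=.
      by rewrite onth_cat lt_is.
    by rewrite onthE (nth_map (z (i - size s))).
  rewrite !onth_default // xE.
  by case: (bpath_val y) => [w t|z] /=; rewrite ?size_mkseq // size_take;
    case: ifP; lia.
elim: s v x ps => [|e s IH] v x /=.
  move=> _ [xv _]; exists x; split=> //; case: x xv => -[w t|z] xP //= xv.
    by rewrite xv.
  by congr Inf; apply: funext => i; rewrite nth_nil subn0.
move=> [ev ps] [xv xs].
have x0 : prepath_onth x 0 = Some e.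
  by rewrite -(@onth_initial _ _ (size s).+1) // xs.
move: xs; rewrite (initialS _ x0) => -[xs].
have [y [ysrc xE]] := IH (rng e) (shift x) ps (conj (src_shift x0) xs).
exists y; split=> //.
case: x xv x0 xE {xs} => -[w [|f t]|z] xP //=; case: (bpath_val y) => [w' t'|z'] //=.
  by move=> -> [->] [->].
move=> _ [z0] [zE]; congr Inf; apply: funext => -[|i] //=.
by rewrite (congr1 (fun f => f i) zE).
Qed.

Lemma cylinder0 v x : cylinder v [::] x <-> prepath_src x = v.
Proof. by rewrite cylinderP // initial0; split=> [[]|]. Qed.

Lemma cylinder_head e x : cylinder (src e) [:: e] x <-> prepath_onth x 0 = Some e.
Proof.
rewrite cylinderP //=; split=> [[_ x1]|x0].
  by rewrite -(@onth_initial x 0 1) ?x1.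
rewrite (initialS _ x0); split; first exact: src_head.
by rewrite initial0.
Qed.

Lemma cylinder_shift v e s x : is_path v (e :: s) -> prepath_onth x 0 = Some e ->
  cylinder v (e :: s) x <-> cylinder (rng e) s (shift x).
Proof.
move=> [ev ps] x0; rewrite !cylinderP // /= (initialS _ x0) (src_shift x0).
by rewrite (src_head x0) ev; split=> [[_ [->]]|[_ ->]].
Qed.

Lemma is_path_initial x n : is_path (prepath_src x) (initial n x).
Proof.
elim: n x => [|n IH] x; first by case: x => -[v s|z] ? //=; rewrite take0.
have [/bpath_ge1P[e xe]|] := pselect (bpath_ge 1 x).
  rewrite (initialS _ xe) /=; split; first by rewrite (src_head xe).
  by rewrite -(src_shift xe); exact: IH.
by case: x => -[v [|f s]|z] xP // [].
Qed.

Lemma cylinder_src v s x : is_path v s -> cylinder v s x -> prepath_src x = v.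
Proof. by move=> ps /(cylinderP _ ps)[]. Qed.

Lemma cylinder_initial n x : bpath_ge n x ->
  cylinder (prepath_src x) (initial n x) x.
Proof.
move=> xn; rewrite cylinderP; last exact: is_path_initial.
split=> //; congr initial; case: x xn => -[v s|z] ? /=; rewrite ?size_mkseq //.
by rewrite /bpath_ge /= => le; rewrite size_takel.
Qed.

Lemma cons_boundary e x : prepath_src x = rng e ->
  exists y, shift y = x /\ prepath_onth y 0 = Some e.
Proof.
case: x => -[v s|z] xP /= xe.
  have yP : is_boundary (Fin (src e) (e :: s)).
    by case: xP => ps sing; subst v.
  by exists (BPath yP); split=> //; apply: bpath_inj => /=; rewrite xe.
have yP : is_boundary (Inf (fun i => if i is j.+1 then z j else e)).
  by case=> [|i] //=; exact: xP.
by exists (BPath yP); split=> //; apply: bpath_inj.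
Qed.

Lemma shift_inj e x y : prepath_onth x 0 = Some e -> prepath_onth y 0 = Some e ->
  shift x = shift y -> x = y.
Proof.
move=> x0 y0 xy; apply: bpath_ext; first by rewrite (src_head x0) (src_head y0).
by case=> [|i]; [rewrite x0 y0|rewrite -!onth_shift xy].
Qed.

Lemma bpath_ge_le m n x : m <= n -> bpath_ge n x -> bpath_ge m x.
Proof. by case: x => -[v s|z] ? //= le_mn; exact: leq_trans. Qed.

(** Whatever leaves the range of an initial segment of [x] can be glued to that
    segment; this produces every point of the cylinder of the segment. *)
Lemma prepend_initial n x y : bpath_ge n x -> prepath_src y = prepath_src (iter n shift x) ->
  exists2 x', iter n shift x' = y & prepath_src x' = prepath_src x /\
    (forall i, i < n -> prepath_onth x' i = prepath_onth x i).
Proof.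
elim: n x => [|n IH] x; first by exists y.
move=> xn; have /bpath_ge1P[e x0] := bpath_ge_le (ltn0Sn n) xn.
have xn' : bpath_ge n (shift x).
  by apply/(@bpath_ge_shift _ n 1); [apply/bpath_ge1P; exists e|rewrite addn1].
move=> ysrc; rewrite iterSr in ysrc.
have [x' x'y [x'src x'x]] := IH _ xn' ysrc.
have [|x'' [x''x' x''0]] := @cons_boundary e x'.
  by rewrite x'src (src_shift x0).
exists x''; first by rewrite iterSr x''x'.
split; first by rewrite (src_head x''0) (src_head x0).
by case=> [|i] lt_i; rewrite ?x0 // -!onth_shift x''x' x'x.
Qed.

(** * Cylinders are clopen *)

Lemma nbhs_basisP x (A : set (bpath E)) : nbhs x A <->
  exists v s F, [/\ is_path v s, finite_set F, F `<=` out_edges (path_rng v s),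
    cylinder_diff v s F x & cylinder_diff v s F `<=` A].
Proof.
rewrite nbhsE; split.
  move=> [B [[D DB <-] [C DC xC]] BA].
  have [v [s [F [ps finF sF CE]]]] := DB _ DC.
  exists v, s, F; split=> //; first by rewrite -CE.
  by apply: subset_trans BA; rewrite -CE; exact: bigcup_sup.
move=> [v [s [F [ps finF sF xB BA]]]].
exists (cylinder_diff v s F) => //; split=> //.
exists [set cylinder_diff v s F]; last by rewrite bigcup_set1.
by move=> _ ->; exists v, s, F.
Qed.

Lemma nbhs_cylinder v s x : is_path v s -> cylinder v s x ->
  nbhs x (cylinder v s).
Proof.
move=> ps xs; apply/nbhs_basisP; exists v, s, set0.
rewrite /cylinder_diff bigcup_set0 setD0; split=> //; exact: finite_set0.
Qed.

Lemma near_src x : \forall x' \near x, prepath_src (bpath_val x') = prepath_src x.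
Proof.
have /nbhs_cylinder : cylinder (prepath_src x) [::] x by exact/cylinder0.
by move=> /(_ I); apply: filterS => y /cylinder0.
Qed.

Lemma nbhs_head x e : prepath_onth x 0 = Some e ->
  \forall x' \near x, prepath_onth (bpath_val x') 0 = Some e.
Proof.
move=> /cylinder_head xe; apply: filterS (nbhs_cylinder _ xe) => //.
by move=> y /cylinder_head.
Qed.

(** If [x] starts with the edge [e], then prefixing [e] turns a basic
    neighbourhood of the shift of [x] into a basic neighbourhood of [x] which
    the shift maps back into the first one. *)
Lemma shift_continuous x : bpath_ge 1 x -> {for x, continuous (@shift E)}.
Proof.
move=> /bpath_ge1P[e x0] A /nbhs_basisP[v [s [F [ps finF sF [xs xF] FA]]]].
have ev : rng e = v by rewrite -(src_shift x0) (cylinder_src ps xs).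
have pes : is_path (src e) (e :: s) by rewrite /= ev.
apply/nbhs_basisP; exists (src e), (e :: s), F; rewrite /path_rng /= ev.
split=> //.
  split; first by rewrite cylinder_shift // ev.
  move=> [f Ff]; rewrite rcons_cons cylinder_shift ?ev; last by [].
    by move=> xf; apply: xF; exists f.
  by rewrite -rcons_cons -cats1 is_path_cat /=; split=> //; split=> //;
    rewrite /path_rng /= ev; exact: sF.
move=> y [ys yF]; apply: FA.
have y0 : prepath_onth y 0 = Some e by rewrite (cylinder_onth ys).
split; first by rewrite -ev; apply/(cylinder_shift pes y0).
move=> [f Ff yf]; apply: yF; exists f => //.
rewrite rcons_cons cylinder_shift ?ev //.
rewrite -rcons_cons -cats1 is_path_cat /=; split=> //; split=> //.
by rewrite /path_rng /= ev; exact: sF.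
Qed.

Lemma near_seq (T : Type) (I : eqType) (G : set_system T) {FG : Filter G}
    (r : seq I) (P : I -> T -> Prop) :
  (forall i, i \in r -> \forall t \near G, P i t) ->
  \forall t \near G, forall i, i \in r -> P i t.
Proof.
elim: r => [_|i r IH Pr]; first exact: nearW.
have := IH (fun j jr => Pr j (mem_behead (s := i :: r) jr)).
apply: filterS2 (Pr i (mem_head _ _)) => t Pi Pr' j.
by rewrite inE => /orP[/eqP ->|]; [exact: Pi|exact: Pr'].
Qed.

(** A cylinder is open by definition of the topology. A path outside it leaves
    the defining path at a first edge, which induction and the continuity of
    the shift reduce to position 0. The path might also stop there, at an
    infinite emitter or a sink, and is then separated from the cylinder by
    forbidding that single edge. *)
Lemma cylinder_clopen v s x : is_path v s ->
  \forall x' \near x, cylinder v s x' <-> cylinder v s x.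
Proof.
elim: s v x => [|e s IH] v x ps.
  apply: filterS (near_src x) => x' x'x; by rewrite !cylinder0 x'x.
have [ev pres] := ps.
have [x0|x0] := pselect (prepath_onth x 0 = Some e).
  have x1 : bpath_ge 1 x by apply/bpath_ge1P; exists e.
  have := shift_continuous x1 (IH (rng e) (shift x) pres).
  apply: filterS2 (nbhs_head x0) => x' x'0 /= x'x.
  by rewrite !cylinder_shift.
suff : \forall x' \near x, prepath_onth (bpath_val x') 0 <> Some e.
  apply: filterS => x' x'0.
  split=> /cylinder_onth => /(_ 0 isT) //.
have [/bpath_ge1P[f xf]|x1] := pselect (bpath_ge 1 x).
  by apply: filterS (nbhs_head xf) => x' -> fe; apply: x0; rewrite xf.
have [xv|xv] := pselect (prepath_src x = v); last first.
  apply: filterS (near_src x) => x' x'x /src_head x'e; apply: xv.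
  by rewrite -x'x x'e.
have x0' f : prepath_onth x 0 <> Some f.
  by move=> xf; apply: x1; apply/bpath_ge1P; exists f.
apply/nbhs_basisP; exists v, [::], [set e]; split=> //.
- by move=> _ ->.
- split.
    exact/cylinder0.
  by move=> [_ -> /= xe]; apply: x0; rewrite (cylinder_onth xe).
- move=> y [_ yF] ye; apply: yF; exists e => //=.
  by rewrite -ev; exact/cylinder_head.
Qed.

(** The topology is generated by the cylinders and their complements, so that
    convergence is tested on cylinders only, without the finite sets of
    forbidden edges. *)
Lemma cvg_bpath (T : Type) (G : set_system T) {FG : Filter G} (g : T -> bpath E) x :
  (forall v s, is_path v s ->
     \forall t \near G, cylinder v s (g t) <-> cylinder v s x) ->
  g @ G --> x.
Proof.
move=> gx A /nbhs_basisP[v [s [F [ps finF sF [xs xF] FA]]]].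
have /finite_seqP[r rE] := finF.
have : \forall t \near G, forall e, e \in r -> ~ cylinder v (rcons s e) (g t).
  apply: near_seq => e er.
  have : is_path v (rcons s e).
    by rewrite -cats1 is_path_cat; split=> //; split=> //; apply: sF; rewrite rE.
  move=> /gx; apply: filterS => t -> xe.
  by apply: xF; exists e => //; rewrite rE.
apply: filterS2 (gx _ _ ps) => t ts tF; apply: FA; split; first exact/ts.
by move=> [e]; rewrite rE => /tF.
Qed.

End BoundaryPaths.

(** * The shift is a local homeomorphism *)

Section LocalHomeo.
Variable E : digraph.
Implicit Types (x y z : bpath E) (v : vert E) (s : seq (edge E)) (e : edge E).

Lemma bpath_ge0 x : bpath_ge 0 x.
Proof. by case: x => -[]. Qed.

Lemma bpath_geD m n x :
  bpath_ge (m + n) x <-> bpath_ge n x /\ bpath_ge m (iter n shift x).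
Proof.
split=> [xmn|[xn xm]]; last exact/(bpath_ge_shift m xn).
have xn := bpath_ge_le (leq_addl m n) xmn.
by split=> //; apply/(bpath_ge_shift m xn).
Qed.

Lemma near_onth n x : bpath_ge n x -> \forall x' \near x,
  forall i, i < n -> prepath_onth (bpath_val x') i = prepath_onth x i.
Proof.
move=> xn; have := cylinder_initial xn.
move=> /(nbhs_cylinder (is_path_initial x n)); apply: filterS => y yx i lt_in.
have sz : size (initial n x) = n.
  case: (x) xn => -[v s|z] ? /=; rewrite ?size_mkseq //.
  by rewrite /bpath_ge /= => le; rewrite size_takel.
by rewrite (cylinder_onth yx) ?sz // onth_initial.
Qed.

Lemma near_bpath_ge n x : bpath_ge n x -> \forall x' \near x, bpath_ge n x'.
Proof.
move=> xn; apply: filterS (near_onth xn) => x' x'x.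
by apply/bpath_geP => i lt_in; rewrite x'x //; move/bpath_geP: xn; apply.
Qed.

Lemma iter_shift_continuous n x : bpath_ge n x ->
  {for x, continuous (iter n (@shift E))}.
Proof.
elim: n => [_|n IH]; first exact: cvg_id.
rewrite -add1n => /bpath_geD[xn x1].
exact: continuous_comp (IH xn) (shift_continuous x1).
Qed.

(** Besides inverting [iter n shift] on the right near the image of [x], the
    section inverts it on the left near [x]: this is local injectivity. *)
Definition local_section n x (g : bpath E -> bpath E) :=
  [/\ g (iter n shift x) = x, g @ iter n shift x --> x,
      \forall y \near iter n shift x, bpath_ge n (g y) /\ iter n shift (g y) = y &
      \forall x' \near x, g (iter n shift x') = x'].

(** The section puts the first edge of [x] in front of a path. *)
Lemma local_section1 x : bpath_ge 1 x -> exists g, local_section 1 x g.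
Proof.
move=> /bpath_ge1P[e x0].
have /choice[g gP] y : exists w, prepath_src (bpath_val y) = rng e ->
    shift w = y /\ prepath_onth (bpath_val w) 0 = Some e.
  have [/cons_boundary[w]|] := pselect (prepath_src y = rng e); first by exists w.
  by exists y.
have gx x' : prepath_onth (bpath_val x') 0 = Some e -> g (shift x') = x'.
  move=> x'0; have [gx' gx'0] := gP _ (src_shift x'0).
  exact: shift_inj gx'0 x'0 gx'.
have ysrc : \forall y \near shift x, prepath_src (bpath_val y) = rng e.
  by rewrite -(src_shift x0); exact: near_src.
exists g; split.
- exact: gx.
- apply: (@cvg_bpath _ _ (nbhs (shift x))) => v [|f s] ps.
    apply: filterS ysrc => y /gP[_ /src_head ysrc].
    by rewrite !cylinder0 ysrc (src_head x0).
  have [ef|ef] := pselect (e = f).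
    subst f; have [_ ps'] := ps.
    apply: filterS2 ysrc (cylinder_clopen (shift x) ps') => y /gP[gy gy0] ys.
    by rewrite !cylinder_shift // gy.
  apply: filterS ysrc => y /gP[_ y0].
  split=> /cylinder_onth => /(_ 0 isT); rewrite ?y0 ?x0 /= => -[fe];
    by case: ef.
- by apply: filterS ysrc => y /gP[? y0]; split=> //; apply/bpath_ge1P; exists e.
- exact: filterS (nbhs_head x0).
Qed.

Lemma local_sectionP n x : bpath_ge n x -> exists g, local_section n x g.
Proof.
elim: n => [|n IH xn].
  move=> _; exists id; split=> //; last exact: (@nearW _ (nbhs x)).
  by apply: (@nearW _ (nbhs x)) => y; split=> //; exact: bpath_ge0.
move: xn; rewrite -add1n => /bpath_geD[xn x1].
have [g [gx gc gs gi]] := IH xn.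
have [g1 [gx1 gc1 gs1 gi1]] := local_section1 x1.
exists (g \o g1); split.
- by rewrite /= gx1.
- exact: cvg_comp gc1 gc.
- apply: filterS2 gs1 (gc1 _ gs) => y [y1 /= sy] [gyn gys] /=.
  rewrite gys sy; split=> //.
  by rewrite add1n -[n.+1]add1n; apply/bpath_geD; rewrite gys.
- apply: filterS2 gi (iter_shift_continuous xn gi1) => y gy gy1 /=.
  by rewrite [g1 _]gy1.
Qed.

End LocalHomeo.

(** * Neighbourhoods of an arrow *)

Section ArrowTopology.
Variable E : digraph.
Implicit Types (x y z : bpath E) (a b : arrow E).

Lemma near_fst (X Y : topologicalType) (x : X) (y : Y) (P : X -> Prop) :
  (\forall x' \near x, P x') -> \forall p \near (x, y), P p.1.
Proof. by move=> Px; exact: (@cvg_fst _ _ (nbhs x) (nbhs y) _ _ Px). Qed.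

Lemma near_snd (X Y : topologicalType) (x : X) (y : Y) (P : Y -> Prop) :
  (\forall y' \near y, P y') -> \forall p \near (x, y), P p.2.
Proof. by move=> Py; exact: (@cvg_snd _ _ (nbhs x) (nbhs y) _ _ Py). Qed.

(** The exponents of an arrow are determined up to a common shift; near the
    arrow the choice is immaterial. Raising them is harmless, and lowering them
    uses the local injectivity of the shift. *)
Lemma shift_eq_near m n m' n' x y : m + n' = m' + n ->
  shift_eq m x n y -> shift_eq m' x n' y ->
  \forall p \near (x, y), shift_eq m p.1 n p.2 -> shift_eq m' p.1 n' p.2.
Proof.
move=> mn [xm yn xy] [xm' yn' xy'].
have [le_mm'|/ltnW le_m'm] := leqP m m'.
  have [j m'E] : exists j, m' = j + m by exists (m' - m); lia.
  have n'E : n' = j + n by lia.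
  subst m' n'; apply: filterS (near_snd _ (near_bpath_ge yn')) => p.
  by move=> pj /shift_eqD; apply.
have [j mE] : exists j, m = j + m' by exists (m - m'); lia.
have nE : n = j + n' by lia.
subst m n; have /bpath_geD[_ wj] := xm.
have [g [_ _ _ gi]] := local_sectionP wj.
have xg := iter_shift_continuous xm' gi.
rewrite xy' in gi; have yg := iter_shift_continuous yn' gi.
apply: filterS2 (near_fst y xg) (near_snd x yg) => -[x1 y1] /= x1g y1g.
move=> [/bpath_geD[x1m' _] /bpath_geD[y1n' _]]; rewrite !iterD => x1y1.
by split=> //; rewrite -x1g -[RHS]y1g x1y1.
Qed.

(** The open sets entering the subbasis of the arrow topology are required to
    be domains of injectivity; these form neighbourhood bases. *)
Lemma injective_nbhs n x U : bpath_ge n x -> nbhs x U ->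
  exists U', [/\ U' `<=` U, U' x & shift_injective_open n U'].
Proof.
move=> xn xU; have [g [_ _ _ gi]] := local_sectionP xn.
have xW : nbhs x [set y | [/\ U y, bpath_ge n y & g (iter n shift y) = y]].
  by apply: filterS3 xU (near_bpath_ge xn) gi.
move: xW; rewrite nbhsE => -[W [oW Wx] WU]; exists W; split=> //.
  by move=> y /WU[].
split=> // [y /WU[] //|y z]; move=> /set_mem/WU[_ _ gy] /set_mem/WU[_ _ gz] yz.
by rewrite -gy yz.
Qed.

Lemma open_iter_shift n (U : set (bpath E)) : U `<=` bpath_ge n -> open U ->
  open (iter n shift @` U).
Proof.
move=> Un; rewrite !openE => oU _ [x Ux <-].
have [g [_ gc gs _]] := local_sectionP (Un _ Ux).
apply: filterS2 gs (gc _ (oU _ Ux)) => y [_ gy] Ugy.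
by exists (g y).
Qed.

Lemma open_preimage_shift n (U W : set (bpath E)) :
  shift_injective_open n U -> open W ->
  shift_injective_open n (U `&` iter n shift @^-1` W).
Proof.
move=> [Un oU injU] oW; split=> [x [/Un] //||x y]; last first.
  by move=> /set_mem[Ux _] /set_mem[Uy _]; apply: injU; exact: mem_set.
rewrite openE => x [Ux Wx]; apply: filterI; first exact: open_nbhs_nbhs.
by apply: (iter_shift_continuous (Un _ Ux)); exact: open_nbhs_nbhs.
Qed.

Lemma arrow_subbasis_open A : @arrow_subbasis E A -> open A.
Proof.
move=> AE; exists [set A]; last by rewrite bigcup_set1.
by move=> _ ->; exact: (@finI_from1 _ _ _ id).
Qed.

(** The arrows near [a] are those with the integer of [a], with ends near
    those of [a], and related through any one pair of exponents [m, n] valid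
    for [a]. *)
Lemma nbhs_arrowP m n a A : shift_eq m (arrow_l a) n (arrow_r a) ->
  arrow_int a = (m%:Z - n%:Z)%R ->
  nbhs a A <-> \forall p \near (arrow_l a, arrow_r a),
    forall b, arrow_l b = p.1 -> arrow_r b = p.2 -> arrow_int b = arrow_int a ->
      shift_eq m p.1 n p.2 -> A b.
Proof.
move=> amn aE; split.
  rewrite nbhsE => -[B [[D DB <-] [C DC aC]] CA].
  have [J JE CE] := DB _ DC.
  have : \forall p \near (arrow_l a, arrow_r a),
    forall S, S \in finmap.enum_fset J -> forall b, arrow_l b = p.1 -> arrow_r b = p.2 -> arrow_int b = arrow_int a ->
      shift_eq m p.1 n p.2 -> S b.
    apply: (@near_seq _ _ (nbhs (arrow_l a, arrow_r a))) => S JS.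
    have /set_mem SE := JE _ JS.
    have aS : S a by move: aC; rewrite -CE; exact.
    have [U [m' [n' [V [[_ oU _] [_ oV _] _ SUV]]]]] := SE.
    move: aS; rewrite SUV => -[aU aE' aV amn'].
    have mn : m + n' = m' + n by lia.
    have aU' : nbhs (arrow_l a) U by exact: open_nbhs_nbhs.
    have aV' : nbhs (arrow_r a) V by exact: open_nbhs_nbhs.
    apply: filterS3 (shift_eq_near mn amn amn') (near_fst (arrow_r a) aU')
      (near_snd (arrow_l a) aV') => p pmn pU pV b bl br bE.
    by move=> /pmn pmn'; split; rewrite ?bl ?br ?bE.
  apply: filterS => p pS b bl br bE pmn; apply: CA; exists C => //=.
  by rewrite -CE => S JS; apply: pS pmn.
move=> [[U V] /= [aU aV] UVA]; have [xm yn xy] := amn.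
have [U0 [U0U U0x injU0]] := injective_nbhs xm aU.
have [V0 [V0V V0y injV0]] := injective_nbhs yn aV.
pose W := (iter m shift @` U0) `&` (iter n shift @` V0).
have oW : open W.
  case: injU0 injV0 => [U0m oU0 _] [V0n oV0 _].
  by apply: openI; exact: open_iter_shift.
(* Cutting down to the common image W makes both images equal, as the subbasis
   demands. *)
pose U1 := U0 `&` iter m shift @^-1` W.
pose V1 := V0 `&` iter n shift @^-1` W.
have UW : iter m shift @` U1 = W.
  apply/seteqP; split=> [_ [x [_ Wx] <-] //|w Ww].
  by have [[x U0x' xw] _] := Ww; exists x => //; split=> //=; rewrite xw.
have VW : iter n shift @` V1 = W.
  apply/seteqP; split=> [_ [x [_ Wx] <-] //|w Ww].
  by have [_ [x V0x xw]] := Ww; exists x => //; split=> //=; rewrite xw.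
have Wx : W (iter m shift (arrow_l a)).
  by split; [exists (arrow_l a)|exists (arrow_r a)].
rewrite nbhsE; exists (arrow_set U1 m n V1).
  split; last by split=> //; split=> //=; rewrite -xy.
  apply: arrow_subbasis_open; exists U1, m, n, V1.
  by split=> //; [exact: open_preimage_shift..|rewrite UW VW].
move=> b [[/U0U bU _] bE [/V0V bV _] bmn].
by apply: (UVA (arrow_l b, arrow_r b)); rewrite ?bE.
Qed.

End ArrowTopology.

(** * Families of arrows with locally constant exponents *)

Section Uniform.
Variable E : digraph.
Implicit Types (x y z : bpath E) (a b : arrow E).

(** Two consecutive arrows get a common middle exponent, the maximum of [n] and
    [p]. The increments depend on the exponents only, which is what makes
    composition compatible with local uniformity. *)
Lemma shift_eq_align m n x y p q z : shift_eq m x n y -> shift_eq p y q z ->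
  shift_eq ((p - n) + m) x ((p - n) + n) y /\
  shift_eq ((n - p) + p) y ((n - p) + q) z.
Proof.
move=> xy yz; have [_ yn _] := xy; have [yp _ _] := yz.
have ynp : bpath_ge (maxn n p) y by case: (leqP n p).
split; first by apply: shift_eqD => //; rewrite addnC -maxnE.
apply: shift_eq_sym; apply: shift_eqD; first exact: shift_eq_sym.
by rewrite addnC -maxnE maxnC.
Qed.

Lemma shift_eq_trans m n x y p z : shift_eq m x n y -> shift_eq n y p z ->
  shift_eq m x p z.
Proof. by move=> [xm _ xy] [_ zp yz]; split=> //; rewrite xy. Qed.

(** Near [t0] the triples [(u t, d t, v t)] are arrows with one and the same
    pair of exponents. With the continuity of [u] and [v] this is the continuity
    at [t0] of the family of arrows, but it makes sense without building the
    arrows, and it composes like arrows do. *)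
Definition uniform_lag (T : topologicalType) (t0 : T) (u : T -> bpath E)
    (d : T -> int) (v : T -> bpath E) :=
  exists m n, \forall t \near t0, d t = (m%:Z - n%:Z)%R /\ shift_eq m (u t) n (v t).

Lemma uniform_lag_sym (T : topologicalType) (t0 : T) u d v :
  uniform_lag t0 u d v -> uniform_lag t0 v (fun t => - d t)%R u.
Proof.
move=> [m [n mn]]; exists n, m; apply: filterS mn => t [-> /shift_eq_sym].
by rewrite opprB.
Qed.

Lemma uniform_lag_trans (T : topologicalType) (t0 : T) u d v e w :
  uniform_lag t0 u d v -> uniform_lag t0 v e w ->
  uniform_lag t0 u (fun t => d t + e t)%R w.
Proof.
move=> [m [n mn]] [p [q pq]]; exists ((p - n) + m), ((n - p) + q).
apply: filterS2 mn pq => t [-> uv] [-> vw]; split; first by lia.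
have [uv' vw'] := shift_eq_align uv vw; apply: shift_eq_trans uv' _.
by have <- : n - p + p = p - n + n by lia.
Qed.

Lemma uniform_lag_eq (T : topologicalType) (t0 : T) u d v u' d' v' :
  (\forall t \near t0, [/\ u t = u' t, d t = d' t & v t = v' t]) ->
  uniform_lag t0 u d v -> uniform_lag t0 u' d' v'.
Proof.
move=> eqs [m [n mn]]; exists m, n.
by apply: filterS2 eqs mn => t [-> -> ->].
Qed.

Lemma uniform_lag_comp (T T' : topologicalType) (f : T' -> T) t0 u d v :
  {for t0, continuous f} -> uniform_lag (f t0) u d v ->
  uniform_lag t0 (u \o f) (d \o f) (v \o f).
Proof. by move=> fG [m [n mn]]; exists m, n; exact: fG mn. Qed.

Lemma near_arrow m n a : shift_eq m (arrow_l a) n (arrow_r a) ->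
  arrow_int a = (m%:Z - n%:Z)%R ->
  \forall b \near a, arrow_int b = (m%:Z - n%:Z)%R /\
    shift_eq m (arrow_l b) n (arrow_r b).
Proof.
move=> amn aE; apply/(nbhs_arrowP _ amn aE).
by apply: (@nearW _ (nbhs (arrow_l a, arrow_r a))) => p b -> -> -> pmn.
Qed.

Lemma uniform_lag_arrow a :
  uniform_lag a (@arrow_l E) (@arrow_int E) (@arrow_r E).
Proof.
have [m [n [aE amn]]] := arrowP a; exists m, n; exact: near_arrow.
Qed.

Lemma arrow_l_continuous : continuous (@arrow_l E).
Proof.
move=> a U aU; have [m [n [aE amn]]] := arrowP a.
apply/(nbhs_arrowP _ amn aE).
by apply: filterS (near_fst (arrow_r a) aU) => p pU b bl _ _ _; rewrite /= bl.
Qed.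

Lemma arrow_r_continuous : continuous (@arrow_r E).
Proof.
move=> a U aU; have [m [n [aE amn]]] := arrowP a.
apply/(nbhs_arrowP _ amn aE).
by apply: filterS (near_snd (arrow_l a) aU) => p pU b _ br _ _; rewrite /= br.
Qed.

Lemma arrow_ext a b : arrow_l a = arrow_l b -> arrow_int a = arrow_int b ->
  arrow_r a = arrow_r b -> a = b.
Proof.
case: a b => [x k y aP] [x' k' y' bP] /= xx kk yy; subst x' k' y'.
by congr Arrow; exact: Prop_irrelevance.
Qed.

Lemma continuous_to_arrow (T : topologicalType) (f : T -> arrow E) t :
  {for t, continuous (@arrow_l E \o f)} -> {for t, continuous (@arrow_r E \o f)} ->
  uniform_lag t (@arrow_l E \o f) (@arrow_int E \o f) (@arrow_r E \o f) ->
  {for t, continuous f}.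
Proof.
move=> fl fr [m [n mn]] A ftA.
have [ftE ftmn] := nbhs_singleton mn.
have /(nbhs_arrowP A ftmn ftE)[[U V] [/= fU fV] UVA] := ftA.
apply: filterS3 mn (fl _ fU) (fr _ fV) => t' [t'E t'mn] t'U t'V.
have /= := UVA (arrow_l (f t'), arrow_r (f t')) (conj t'U t'V).
by apply=> //; exact: etrans t'E (esym ftE).
Qed.

End Uniform.

(** * The groupoid morphism of a shift cocycle *)

Section Cocycles.
Variables E F : digraph.
Variables (h : bpath E -> bpath F) (s : bpath E -> int).
Implicit Types (x y z : bpath E) (a b : arrow E).
Local Open Scope ring_scope.

(** The part of an orbit equivalence that the groupoid sees: only the
    difference [s = l - k] of its two cocycles matters, together with the fact
    that the exponents can be chosen locally constant. *)
Definition shift_cocycle := forall x, bpath_ge 1 x ->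
  uniform_lag x h s (h \o shift).

Definition csum n x : int := \sum_(i < n) s (iter i shift x).

Lemma csumD m n x : csum (m + n) x = csum m x + csum n (iter m shift x).
Proof.
rewrite /csum big_split_ord /=; congr (_ + _); apply: eq_bigr => i _.
by rewrite -iterD addnC.
Qed.

Lemma uniform_lag_csum n x : shift_cocycle -> bpath_ge n x ->
  uniform_lag x h (csum n) (h \o iter n shift).
Proof.
move=> hs; elim: n => [_|n IH].
  exists 0%N, 0%N; apply: (@nearW _ (nbhs x)) => y.
  by rewrite /csum big_ord0; split=> //; split=> //; exact: bpath_ge0.
rewrite -add1n => /bpath_geD[xn x1].
apply: (uniform_lag_eq _ (uniform_lag_trans (IH xn)
  (uniform_lag_comp (iter_shift_continuous xn) (hs _ x1)))).
apply: (@nearW _ (nbhs x)) => y; split=> //.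
by rewrite /csum add1n big_ord_recr.
Qed.

(** The value on an arrow of the groupoid cocycle generated by [s]; the
    exponents are picked by choice, and csum_arrowE shows that they do not
    matter. *)
Definition csum_arrow a : int :=
  csum (projT1 (cid (arrowP a))) (arrow_l a)
  - csum (projT1 (cid (projT2 (cid (arrowP a))))) (arrow_r a).

(** Raising both exponents by [j] adds to both sums the same [j] terms, since
    the two shifted paths coincide. *)
Lemma csum_arrowE m n a : arrow_int a = m%:Z - n%:Z ->
  shift_eq m (arrow_l a) n (arrow_r a) ->
  csum_arrow a = csum m (arrow_l a) - csum n (arrow_r a).
Proof.
rewrite /csum_arrow; case: cid => /= p pP; case: cid => /= q [-> pq] mnpq mn.
clear pP; move: m n p q mnpq pq mn.
(* It is enough to compare two pairs of exponents one of which is larger. *)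
have wlg m n p q j : p = (m + j)%N -> q = (n + j)%N ->
    shift_eq m (arrow_l a) n (arrow_r a) ->
    csum p (arrow_l a) - csum q (arrow_r a) =
    csum m (arrow_l a) - csum n (arrow_r a).
  by move=> -> -> [_ _ mn]; rewrite !csumD mn; lia.
move=> m n p q mnpq pq mn.
have [le_mp|/ltnW le_pm] := leqP m p.
  by apply: (wlg _ _ _ _ (p - m)%N) => //; lia.
by apply/esym/(wlg _ _ _ _ (m - p)%N) => //; lia.
Qed.

(** An arrow is a path of shifts followed by a reversed path of shifts, and
    each single shift is sent to arrows with locally constant exponents. *)
Lemma uniform_lag_csum_arrow a : shift_cocycle ->
  uniform_lag a (h \o @arrow_l E) csum_arrow (h \o @arrow_r E).
Proof.
move=> hs; have [m [n [aE amn]]] := arrowP a; have [xm yn _] := amn.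
have ul := uniform_lag_comp (@arrow_l_continuous _ a) (uniform_lag_csum hs xm).
have ur := uniform_lag_comp (@arrow_r_continuous _ a) (uniform_lag_csum hs yn).
have near_a := near_arrow amn aE.
have ul' : uniform_lag a (h \o @arrow_l E) (csum m \o @arrow_l E)
    (h \o iter n shift \o @arrow_r E).
  apply: uniform_lag_eq ul; apply: filterS near_a => b [_ [_ _ bmn]].
  by rewrite /= bmn.
apply: uniform_lag_eq (uniform_lag_trans ul' (uniform_lag_sym ur)).
by apply: filterS near_a => b [bE bmn] /=; rewrite (csum_arrowE bE bmn).
Qed.

Lemma csum_arrow_mul a b (ab : composable a b) :
  csum_arrow (arrow_mul ab) = csum_arrow a + csum_arrow b.
Proof.
have [m [n [aE amn]]] := arrowP a; have [p [q [bE bpq]]] := arrowP b.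
have bpq' : shift_eq p (arrow_r a) q (arrow_r b) by rewrite ab.
have [amn' bpq''] := shift_eq_align amn bpq'.
have npE : (n - p + p = p - n + n)%N by lia.
rewrite npE in bpq''.
have aE' : arrow_int a = (p - n + m)%N%:Z - (p - n + n)%N%:Z by lia.
have bE' : arrow_int b = (p - n + n)%N%:Z - (n - p + q)%N%:Z by lia.
have abE : arrow_int (arrow_mul ab) = (p - n + m)%N%:Z - (n - p + q)%N%:Z.
  by rewrite /= aE' bE'; lia.
rewrite (csum_arrowE aE' amn') (csum_arrowE bE'); last by rewrite -ab.
by rewrite (csum_arrowE abE (shift_eq_trans amn' bpq'')) /= ab; lia.
Qed.

Lemma csum_arrow_inv a : csum_arrow (arrow_inv a) = - csum_arrow a.
Proof.
have [m [n [aE amn]]] := arrowP a.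
rewrite (csum_arrowE aE amn) (@csum_arrowE n m) ?opprB //=.
  by rewrite aE opprB.
exact: shift_eq_sym.
Qed.

Hypothesis hs : shift_cocycle.

Lemma arrow_push_subproof a : exists m n, csum_arrow a = m%:Z - n%:Z /\
  shift_eq m (h (arrow_l a)) n (h (arrow_r a)).
Proof.
have [m [n mn]] := uniform_lag_csum_arrow a hs.
by exists m, n; exact: nbhs_singleton mn.
Qed.

Definition arrow_push a : arrow F := Arrow (arrow_push_subproof a).

Lemma arrow_push_morphism : groupoid_morphism arrow_push.
Proof.
split=> [a b ab|a]; last by apply: arrow_ext => //=; exact: csum_arrow_inv.
have ab' : composable (arrow_push a) (arrow_push b).
  by rewrite /composable /= ab.
by exists ab'; apply: arrow_ext => //=; exact: csum_arrow_mul.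
Qed.

Lemma arrow_push_continuous : continuous h -> continuous arrow_push.
Proof.
move=> hc a; apply: continuous_to_arrow; last exact: uniform_lag_csum_arrow.
  exact: (continuous_comp (@arrow_l_continuous _ a) (hc (arrow_l a))).
exact: (continuous_comp (@arrow_r_continuous _ a) (hc (arrow_r a))).
Qed.

End Cocycles.

(** * Isotropy and isolated eventually periodic points *)

Section Isotropy.
Variable E : digraph.
Implicit Types (x y z : bpath E) (a b : arrow E).

(** A neighbourhood of [x] is detected on finitely many positions. The
    converse fails for a path ending at an infinite emitter. *)
Lemma nbhs_onth x A : nbhs x A -> exists n, forall y,
  prepath_src y = prepath_src x ->
  (forall i, i < n -> prepath_onth y i = prepath_onth x i) -> A y.
Proof.
move=> /nbhs_basisP[v [s [F [ps finF sF [xs xF] FA]]]].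
exists (size s).+1 => y yx xy; apply: FA; split.
  apply/(cylinderP _ ps); rewrite yx (@eq_initial _ y x).
    exact/(cylinderP _ ps).
  by move=> i lt_is; apply: xy; lia.
move=> [e Fe ye]; apply: xF; exists e => //.
have pse : is_path v (rcons s e).
  by rewrite -cats1 is_path_cat; split=> //; split=> //; exact: sF.
move: ye; rewrite !cylinderP // yx (@eq_initial _ y x) // => i.
by rewrite size_rcons; exact: xy.
Qed.

Lemma open_set1 x : nbhs x [set x] -> open [set x].
Proof. by move=> xx; rewrite openE => _ ->. Qed.

Lemma shift_eq_onth m n x i : shift_eq m x n x ->
  prepath_onth x (m + i) = prepath_onth x (n + i).
Proof. by move=> [_ _ mn]; rewrite -!onth_iter_shift mn. Qed.

(** Two shifts of a finite path by different amounts have different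
    lengths. *)
Lemma shift_eq_infinite m n x : m != n -> shift_eq m x n x ->
  exists w, bpath_val x = Inf w.
Proof.
wlog lt_nm : m n / n < m.
  move=> wlg; rewrite neq_ltn => /orP[lt|lt].
    by move=> /shift_eq_sym; apply: wlg => //; lia.
  by apply: wlg => //; lia.
move=> _ xmn; have [xm _ _] := xmn; have := shift_eq_onth _ xmn.
(* The offset is chosen so that n plus it is the last position of the path. *)
case: x xm {xmn} => -[v s|z] xP /=; last by exists z.
rewrite /bpath_ge /= => le_ms /(_ (size s - n.+1)).
rewrite onth_default; last by lia.
have := onthTE s (n + (size s - n.+1)); case: onth => //.
by move=> /esym/negbT; lia.
Qed.

Lemma bpath_ge_infinite x n : (exists w, bpath_val x = Inf w) -> bpath_ge n x.
Proof. by rewrite /bpath_ge /= => -[z ->]. Qed.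

(** Effectiveness: apart from units, the interior of the isotropy lies over
    isolated eventually periodic points. If all [x'] near [x] satisfy the same
    relation between two different shifts, then each [x'] is determined by
    finitely many of its first edges, and sharing those with [x] it is equal to
    [x]. *)
Lemma isolated_isotropy m n x : m != n ->
  (\forall x' \near x, shift_eq m x' n x') -> isolated_eventually_periodic x.
Proof.
wlog lt_nm : m n / n < m.
  move=> wlg; rewrite neq_ltn => /orP[lt|lt] xmn; last by apply: wlg xmn; lia.
  apply: (wlg n m) => //; first by lia.
  by apply: filterS xmn => y; exact: shift_eq_sym.
move=> mn xmn; have xmn0 := nbhs_singleton xmn.
have xinf := shift_eq_infinite mn xmn0.
split.
  split=> //; exists n, (m - n); rewrite subnKC; last exact: ltnW.
  by split=> //; lia.
apply: open_set1; have [k kP] := nbhs_onth xmn.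
have xk : bpath_ge (maxn k m) x by exact: bpath_ge_infinite.
apply: filterS2 (near_src x) (near_onth xk) => y yx xy.
have ymn : shift_eq m y n y by apply: kP => // i lt_ik; apply: xy; lia.
apply: bpath_ext => // i.
(* Beyond the known edges, periodicity moves a position back by m - n. *)
elim/ltn_ind: i => i IH; have [lt_i|le_i] := ltnP i (maxn k m); first exact: xy.
have -> : i = m + (i - m) by lia.
by rewrite (shift_eq_onth _ ymn) (shift_eq_onth _ xmn0); apply: IH; lia.
Qed.

(** If [x] is isolated, then far enough along [x] no path can branch off. *)
Lemma isolated_tail x : open [set x] -> exists n0, forall n, n0 <= n ->
  bpath_ge n x -> forall y, prepath_src y = prepath_src (iter n shift x) ->
  y = iter n shift x.
Proof.
move=> ox; have : nbhs x [set x] by exact: open_nbhs_nbhs.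
move=> /nbhs_onth[n0 n0P]; exists n0 => n le_n xn y ysrc.
have [x' <- [x'src x'x]] := prepend_initial xn ysrc.
by rewrite (n0P x') // => i lt_i; apply: x'x; lia.
Qed.

(** The existence of an arrow from [x] to [y] with integer [k]. *)
Definition lag (x : bpath E) (k : int) (y : bpath E) :=
  exists m n, k = (m%:Z - n%:Z)%R /\ shift_eq m x n y.

Local Open Scope ring_scope.

Lemma lag_shift n x : bpath_ge n x -> lag x n%:Z (iter n shift x).
Proof. by move=> xn; exists n, 0%N; split; [lia|split=> //; exact: bpath_ge0]. Qed.

Lemma lag_refl x : lag x 0 x.
Proof. exact: (lag_shift (bpath_ge0 x)). Qed.

Lemma lag_sym x k y : lag x k y -> lag y (- k) x.
Proof. by move=> xy; exact: arrowP (arrow_inv (Arrow xy)). Qed.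

Lemma lag_trans x k y l z : lag x k y -> lag y l z -> lag x (k + l) z.
Proof.
move=> xy yz.
exact: arrowP (@arrow_mul _ (Arrow xy) (Arrow yz) erefl).
Qed.

Lemma lag_mulz (q k : int) x : lag x k x -> lag x (q * k) x.
Proof.
move=> xk; have nat_case (n : nat) : lag x (n%:Z * k) x.
  elim: n => [|n IH]; first by rewrite mul0r; exact: lag_refl.
  have -> : n.+1%:Z * k = k + n%:Z * k by lia.
  exact: lag_trans IH.
case: q => n; first exact: nat_case.
have -> : Negz n * k = - (n.+1%:Z * k) by lia.
exact: lag_sym.
Qed.

Lemma lag_isotropy x j y k : lag x j y -> lag x k x <-> lag y k y.
Proof.
move=> xy; have yx := lag_sym xy; split=> [xx|yy].
  have := lag_trans yx (lag_trans xx xy).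
  by have -> : - j + (k + j) = k by lia.
have := lag_trans xy (lag_trans yy yx).
by have -> : j + (k + - j) = k by lia.
Qed.

Definition isotropy_generator x (p : nat) :=
  (0 < p)%N /\ forall k : int, lag x k x <-> exists q, k = q * p%:Z.

Definition period x : nat := xget 0%N (isotropy_generator x).

(** The isotropy at an eventually periodic point is a subgroup of the
    integers, nontrivial by periodicity, hence generated by its least positive
    element. *)
Lemma periodP x : eventually_periodic x -> isotropy_generator x (period x).
Proof.
move=> [xinf [n [p [p0 xnp]]]]; rewrite /period.
suff [p' p'P] : exists p', isotropy_generator x p' by exact: (@xgetI _ 0%N _ p').
have ex : exists q, (0 < q)%N && `[< lag x q%:Z x >].
  by exists p; rewrite p0; apply/asboolP; exists (n + p)%N, n; split=> //; lia.
case: (ex_minnP ex) => q /andP[q0 /asboolP xq] qmin.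
exists q; split=> // k; split=> [xk|[r ->]]; last exact: lag_mulz.
have q0' : q%:Z != 0 by lia.
exists (k %/ q%:Z)%Z; have kE := divz_eq k q%:Z.
have r0 := modz_ge0 k q0'.
have rq := ltz_mod k q0'.
suff : ~ 0 < (k %% q%:Z)%Z by lia.
move=> rpos; have := qmin `|(k %% q%:Z)%Z|%N.
rewrite (_ : (0 < `|(k %% q%:Z)%Z|)%N = true) /=; last by lia.
suff -> : `[< lag x `|(k %% q)%Z|%N x >] by lia.
apply/asboolP; have := lag_trans xk (lag_mulz (- (k %/ q%:Z)%Z) xq).
by congr lag; lia.
Qed.

Lemma period_orbit x j y : lag x j y -> period x = period y.
Proof.
move=> xy; rewrite /period; congr xget; apply/seteqP; split=> p [p0 pP];
  split=> // k.
  exact: iff_trans (iff_sym (lag_isotropy k xy)) (pP k).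
exact: iff_trans (lag_isotropy k xy) (pP k).
Qed.

(** A purely periodic point on a cycle without exits. No other boundary path
    starts at its source, hence a cylinder of a vertex contains at most one
    such point. *)
Definition cycle_point z :=
  [/\ forall y, prepath_src y = prepath_src z -> y = z,
      iter (period z) shift z = z & eventually_periodic z].

Lemma cycle_point_isolated z : cycle_point z -> nbhs z [set z].
Proof. by move=> [zP _ _]; apply: filterS (near_src z) => y /zP. Qed.

(** Shift [x] first until it is periodic, and then until no path branches
    off. *)
Lemma orbit_cycle_point x : isolated_eventually_periodic x ->
  exists z, (exists j, lag x j z) /\ cycle_point z.
Proof.
move=> [xper ox]; have [xinf _] := xper.
have [n0 n0P] := isolated_tail ox; have [p0 pP] := periodP xper.
have [|m [n [pE xmn]]] := (pP (period x)%:Z).2; first by exists 1; lia.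
have xge i : bpath_ge i x by exact: bpath_ge_infinite.
pose N := (n0 + n)%N; have xN : lag x N%:Z (iter N shift x) by exact: lag_shift.
have [_ _ mn] := xmn.
have zp : iter (period x) shift (iter N shift x) = iter N shift x.
  have mE : (m = period x + n)%N by lia.
  by rewrite /N -iterD addnCA -mE !iterD mn.
exists (iter N shift x); split; first by exists N%:Z.
split.
- by apply: n0P => //; rewrite /N leq_addr.
- by rewrite -(period_orbit xN).
- have zinf : exists w, bpath_val (iter N shift x) = Inf w.
    elim: N {xN zp} => [//|N [w wE]] /=; exists (fun i => w i.+1).
    by rewrite /= wE.
  split=> //; exists 0%N, (period x); split=> //.
  by split=> //; exact: bpath_ge_infinite.
Qed.

(** A choice function applied to the set of cycle points of an orbit, which
    depends on the orbit only. *)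
Lemma orbit_representatives : exists rep : bpath E -> bpath E,
  (forall x, isolated_eventually_periodic x ->
    (exists j, lag x j (rep x)) /\ cycle_point (rep x)) /\
  (forall x j y, isolated_eventually_periodic x -> lag x j y ->
    rep x = rep y).
Proof.
have /choice[ch chP] (A : set (bpath E)) : exists o, A !=set0 ->
    exists2 x, o = Some x & A x.
  have [[x Ax]|A0] := pselect (A !=set0); first by exists (Some x); exists x.
  by exists None.
pose S x := [set z | (exists j, lag x j z) /\ cycle_point z].
exists (fun x => odflt x (ch (S x))); split=> [x|x j y] xiep.
  by have [z -> [? ?]] := chP _ (orbit_cycle_point xiep).
move=> xy; have -> : S y = S x.
  apply/seteqP; split=> z [[i yz] zP]; split=> //.
    by eexists; exact: lag_trans xy yz.
  by eexists; exact: lag_trans (lag_sym xy) yz.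
by have [z -> _] := chP _ (orbit_cycle_point xiep).
Qed.

End Isotropy.

(** * Correcting a cocycle on the cycles without exits *)

Section Correction.
Variables E F : digraph.
Variables (h : bpath E -> bpath F) (s : bpath E -> int).
Hypothesis hs : shift_cocycle h s.
Hypothesis hiep : forall x, isolated_eventually_periodic x ->
  eventually_periodic (h x).
Implicit Types (x y z : bpath E) (a b : arrow E).
Local Open Scope ring_scope.

Lemma lag_csum n x : bpath_ge n x -> lag (h x) (csum s n x) (h (iter n shift x)).
Proof.
move=> xn; have [p [q pq]] := uniform_lag_csum hs xn.
by exists p, q; exact: nbhs_singleton pq.
Qed.

Lemma cycle_point_iep z : cycle_point z -> isolated_eventually_periodic z.
Proof. by move=> zP; split; [case: zP|exact/open_set1/cycle_point_isolated]. Qed.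

(** At an isolated eventually periodic point a value of the cocycle can be moved
    by any multiple of the period of the image, so the cocycle may fail to match
    the isotropy groups. It is
    changed at one cycle point [z] per orbit, the unique point of the cycle
    where the correction [t] is nonzero, so that the sum over the cycle of [z]
    becomes the period of [h z].

    The changed cocycle is still continuous: the corrected points are isolated,
    and they do not accumulate, since a cylinder of a vertex contains at most
    one of them. This is why only one point per orbit is touched: the orbits
    themselves may accumulate at a point which is not isolated. *)
Lemma corrected_cycle_cocycle : exists s' : bpath E -> int,
  shift_cocycle h s' /\
  forall x, isolated_eventually_periodic x ->
  exists j z, [/\ lag x j z, cycle_point z &
    csum s' (period z) z = (period (h z))%:Z].
Proof.
have [rep [repP rep_orbit]] := orbit_representatives E.
pose D z := cycle_point z /\ rep z = z.
pose t x : int := if `[< D x >] then (period (h x))%:Z - csum s (period x) x else 0.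
have tD x : D x -> t x = (period (h x))%:Z - csum s (period x) x.
  by move=> xD; rewrite /t; case: asboolP.
have tN x : ~ D x -> t x = 0 by move=> xD; rewrite /t; case: asboolP.
exists (fun x => s x + t x); split.
  move=> x x1; have [m [n mn]] := hs x1.
  have [xD|xND] := pselect (D x); last first.
    exists m, n; apply: filterS2 (near_src x) mn => y yx.
    suff /tN -> : ~ D y by rewrite addr0.
    move=> yD; have [[yP _ _] _] := yD.
    by apply: xND; rewrite (yP x) // yx.
  have hx1 : lag (h x) (s x) (h (shift x)).
    by exists m, n; exact: nbhs_singleton mn.
  have [xcyc _] := xD; have [_ xp xper] := xcyc.
  have [_ hper] := periodP (hiep (cycle_point_iep xcyc)).
  have hx2 : lag (h x) (period (h x))%:Z (h x) by apply/hper; exists 1; lia.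
  have hx3 := lag_csum (bpath_ge_infinite (period x) xper.1).
  rewrite xp in hx3.
  have [p [q [pqE pq]]] := lag_trans (lag_trans hx2 (lag_sym hx3)) hx1.
  exists p, q; apply: filterS (cycle_point_isolated xcyc) => _ ->.
  by split=> //; rewrite tD // -pqE addrC.
move=> x xiep; have [[j xz] zcyc] := repP _ xiep; exists j, (rep x).
have zD : D (rep x) by split=> //; rewrite -(rep_orbit _ _ _ xiep xz).
move: (rep x) zD xz zcyc => z zD xz zcyc; split=> //.
have ziep := cycle_point_iep zcyc.
have [_ zp zper] := zcyc; have [p0 pP] := periodP zper.
rewrite /csum big_split /=.
have -> : \sum_(i < period z) t (iter i shift z) = t z.
  case: (period z) p0 pP => [//|p] _ pP.
  rewrite big_ord_recl /= big1 ?addr0 // => i _; apply: tN => -[_].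
  have zi : lag z i.+1%:Z (iter i.+1 shift z).
    by apply: lag_shift; exact: bpath_ge_infinite zper.1.
  have [_ repz] := zD; rewrite -(rep_orbit _ _ _ ziep zi) repz => ziE.
  rewrite (_ : iter i.+1 shift z = z) in zi; last exact: esym ziE.
  have [q qE] := (pP _).1 zi.
  have ip := ltn_ord i; move: (nat_of_ord i) qE ip => k qE kp {i zi ziE}.
  have [q0|q0] : q <= 0 \/ 1 <= q by lia.
    by nia.
  by nia.
by rewrite tD // addrC subrK.
Qed.

(** The equality for the cycle point [z] extends to all loops at [z] by
    additivity, and to the loops at a point [x] of the orbit of [z] by
    conjugation with an arrow from [x] to [z]. *)
Lemma corrected_cocycle : exists s' : bpath E -> int,
  shift_cocycle h s' /\
  forall a (q : int), isolated_eventually_periodic (arrow_l a) ->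
    arrow_r a = arrow_l a ->
    arrow_int a = q * (period (arrow_l a))%:Z ->
    csum_arrow s' a = q * (period (h (arrow_l a)))%:Z.
Proof.
have [s' [hs' s'P]] := corrected_cycle_cocycle; exists s'; split=> // a q xiep.
have [j [z [xz zcyc zsum]]] := s'P _ xiep; have [_ zp zper] := zcyc.
have zge n : bpath_ge n z by apply: bpath_ge_infinite zper.1.
have znp (n : nat) : iter (n * period z) shift z = z.
  by elim: n => // n IH; rewrite mulSn iterD IH zp.
have znsum (n : nat) : csum s' (n * period z) z = n%:Z * (period (h z))%:Z.
  elim: n => [|n IH]; first by rewrite mul0r /csum big_ord0.
  by rewrite mulSn csumD zp IH zsum; lia.
have loopz b r : arrow_l b = z -> arrow_r b = z ->
    arrow_int b = r * (period z)%:Z -> csum_arrow s' b = r * (period (h z))%:Z.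
  have nat_case (n : nat) c : arrow_l c = z -> arrow_r c = z ->
      arrow_int c = n%:Z * (period z)%:Z ->
      csum_arrow s' c = n%:Z * (period (h z))%:Z.
    move=> cl cr cE; rewrite (@csum_arrowE _ s' (n * period z) 0).
    - by rewrite cl znsum /csum big_ord0 subr0.
    - by lia.
    - by rewrite cl cr; split=> //; rewrite /= znp.
  move=> bl br bE; case: r bE => n bE; first exact: nat_case.
  rewrite -[csum_arrow s' b]opprK -csum_arrow_inv (@nat_case n.+1) //=.
  - by lia.
  - by rewrite bE; lia.
move=> ar aE; pose c := Arrow xz; pose b := Arrow (lag_mulz q (lag_refl z)).
have per : period (arrow_l a) = period z := period_orbit xz.
have zq : lag z (q * (period z)%:Z) z.
  apply/(lag_isotropy _ xz); rewrite -per -aE -{2}ar; exact: arrowP a.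
pose d := Arrow zq.
have cd : composable c d by [].
have cdc : composable (arrow_mul cd) (arrow_inv c) by [].
have -> : a = arrow_mul cdc by apply: arrow_ext => //=; rewrite aE per; lia.
rewrite !csum_arrow_mul csum_arrow_inv (loopz d q) //=.
have -> : period (h (arrow_l a)) = period (h z).
  have hxz := arrowP (arrow_push hs c).
  exact: period_orbit hxz.
by lia.
Qed.

End Correction.

(** * Local bisections and effectiveness *)

Section Bisections.
Variable E : digraph.
Implicit Types (x y z : bpath E) (a b : arrow E).

(** The left end is a local homeomorphism from arrows to paths: [y] follows
    from [x] by a local section of [iter n shift] applied to
    [iter m shift x]. *)
Lemma local_bisection a : exists f : bpath E -> arrow E,
  [/\ f (arrow_l a) = a, {for arrow_l a, continuous f},
      \forall x \near arrow_l a, arrow_l (f x) = x &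
      \forall b \near a, f (arrow_l b) = b].
Proof.
have [m [n [aE amn]]] := arrowP a; have [xm yn xy] := amn.
have [g [gy gc gs gi]] := local_sectionP yn.
(* Where the triple is not an arrow, the value a is arbitrary. *)
have /choice[f fP] x : exists b, shift_eq m x n (g (iter m shift x)) ->
    [/\ arrow_l b = x, arrow_int b = arrow_int a & arrow_r b = g (iter m shift x)].
  have [xgx|] := pselect (shift_eq m x n (g (iter m shift x))); last by exists a.
  have bP : exists m' n' : nat, arrow_int a = (m'%:Z - n'%:Z)%R /\
      shift_eq m' x n' (g (iter m shift x)) by exists m, n.
  by exists (Arrow bP).
rewrite -xy in gc gs.
have sc := iter_shift_continuous xm.
have near_good : \forall x \near arrow_l a, shift_eq m x n (g (iter m shift x)).
  apply: filterS2 (near_bpath_ge xm) (sc _ gs) => x xm' [gn gE].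
  by split=> //; rewrite gE.
have near_f : \forall x \near arrow_l a, [/\ arrow_l (f x) = x,
    arrow_int (f x) = arrow_int a, arrow_r (f x) = g (iter m shift x) &
    shift_eq m x n (g (iter m shift x))].
  by apply: filterS near_good => x xg; have [? ? ?] := fP _ xg; split.
have fa : f (arrow_l a) = a.
  have [fl fi fr _] := nbhs_singleton near_f.
  by apply: arrow_ext; rewrite // fr xy gy.
exists f; split=> //.
- apply: continuous_to_arrow.
  + move=> U /=; rewrite fa => aU.
    by apply: filterS2 near_f aU => x [fx _ _ _] Ux; rewrite /= fx.
  + move=> U /=; rewrite fa => aU.
    apply: filterS2 near_f (sc _ (gc _ aU)) => x [_ _ fx _] Ux.
    by rewrite /= fx.
  + exists m, n; apply: filterS near_f => x [fl fi fr fmn] /=.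
    by rewrite fi fl fr.
- by apply: filterS near_f => x [].
- apply: filterS3 (near_arrow amn aE) (arrow_l_continuous near_f)
    (arrow_r_continuous gi) => b [bE [_ _ bmn]] [fl fi fr _] gb.
  by apply: arrow_ext; rewrite ?fi ?bE ?aE // fr bmn [LHS]gb.
Qed.

Lemma near_arrow_l a (P : bpath E -> Prop) :
  (\forall b \near a, P (arrow_l b)) -> \forall x \near arrow_l a, P x.
Proof.
move=> aP; have [f [fa fc fl _]] := local_bisection a.
rewrite -{1}fa in aP.
by apply: filterS2 fl (fc _ aP) => x /= ->.
Qed.

End Bisections.

Definition homeo_sym (X Y : topologicalType) (h : homeo X Y) : homeo Y X :=
  Homeo (@homeo_invK _ _ h) (@homeo_funK _ _ h) (@homeo_inv_continuous _ _ h)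
    (@homeo_continuous _ _ h).

Section Effective.
Variables E F : digraph.
Variables (h : homeo (bpath E) (bpath F)).
Variables (s : bpath E -> int) (s' : bpath F -> int).
Hypothesis hs : shift_cocycle h s.
Hypothesis hs' : shift_cocycle (homeo_inv h) s'.

(** Pushing forward and back changes the integer of an arrow by some [e], which
    is locally constant. Composing with the inverse of the arrow gives arrows
    [(x', e, x')] with common exponents for all [x'] near [x], and effectiveness
    forces [e = 0] unless [x] is isolated and eventually periodic. *)
Lemma csum_arrow_pushK a : ~ isolated_eventually_periodic (arrow_l a) ->
  csum_arrow s' (arrow_push hs a) = arrow_int a.
Proof.
move=> niep.
have pushc := @arrow_push_continuous _ _ _ _ hs (@homeo_continuous _ _ h) a.
have u1 := uniform_lag_comp pushc (uniform_lag_csum_arrow (arrow_push hs a) hs').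
have u2 : uniform_lag a (@arrow_l E) (csum_arrow s' \o arrow_push hs) (@arrow_r E).
  apply: uniform_lag_eq u1; apply: (@nearW _ (nbhs a)) => b.
  by split=> //=; exact: homeo_funK.
have [m [n mn]] := uniform_lag_trans u2 (uniform_lag_sym (uniform_lag_arrow a)).
have [eq_mn|ne_mn] := eqVneq m n.
  by have [/= + _] := nbhs_singleton mn; rewrite eq_mn; lia.
case: niep; apply: isolated_isotropy ne_mn _.
by apply: near_arrow_l; apply: filterS mn => b [].
Qed.

End Effective.

(** * From orbit equivalence to isomorphism *)

Section Reconstruction.
Variables E F : digraph.

(** A bijective morphism reflects composability: the two units that have to
    agree have the same image. *)
Lemma groupoid_morphism_inv (f : homeo (arrow E) (arrow F)) :
  groupoid_morphism f -> groupoid_morphism (homeo_inv f).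
Proof.
move=> [fM fV]; have f_inj := can_inj (@homeo_funK _ _ f).
have gV a : homeo_inv f (arrow_inv a) = arrow_inv (homeo_inv f a).
  by apply: f_inj; rewrite fV !homeo_invK.
split=> // a b ab.
have cb : composable (arrow_inv (homeo_inv f a)) (homeo_inv f a) by [].
have bc : composable (homeo_inv f b) (arrow_inv (homeo_inv f b)) by [].
have unitE : f (arrow_mul cb) = f (arrow_mul bc).
  have [fcb ->] := fM _ _ cb; have [fbc ->] := fM _ _ bc.
  apply: arrow_ext => /=; rewrite ?fV !homeo_invK /=; [exact: ab|lia|exact: ab].
have gab : composable (homeo_inv f a) (homeo_inv f b).
  exact: (congr1 (@arrow_l E) (f_inj _ _ unitE)).
exists gab; apply: f_inj; rewrite homeo_invK; have [fgab ->] := fM _ _ gab.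
by apply: arrow_ext; rewrite /= !homeo_invK.
Qed.

Variables (h : homeo (bpath E) (bpath F)).
Variables (s : bpath E -> int) (s' : bpath F -> int).
Hypothesis hs : shift_cocycle h s.
Hypothesis hs' : shift_cocycle (homeo_inv h) s'.
Hypothesis hiep : preserves_isolated_eventually_periodic h.
Hypothesis hper : forall a (q : int), isolated_eventually_periodic (arrow_l a) ->
  arrow_r a = arrow_l a -> arrow_int a = (q * (period (arrow_l a))%:Z)%R ->
  csum_arrow s a = (q * (period (h (arrow_l a)))%:Z)%R.

Local Notation push := (arrow_push hs).

Lemma iep_homeo x : isolated_eventually_periodic (h x) <->
  isolated_eventually_periodic x.
Proof.
rewrite -hiep; split=> [[y yiep /(can_inj (@homeo_funK _ _ h)) <-] //|xiep].
by exists x.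
Qed.

(** Over an isolated eventually periodic point the morphism maps generator to
    generator by [hper]; elsewhere the pushforward along the inverse
    homeomorphism inverts it. *)
Lemma push_isotropy_inj a : arrow_r a = arrow_l a -> csum_arrow s a = 0%R ->
  arrow_int a = 0%R.
Proof.
move=> ar a0.
have [xiep|xniep] := pselect (isolated_eventually_periodic (arrow_l a)).
  have [_ pP] := periodP xiep.1.
  have [|q qE] := (pP (arrow_int a)).1; first by rewrite -{2}ar; exact: arrowP.
  have [p0 _] := periodP ((iep_homeo _).2 xiep).1.
  have := hper xiep ar qE; rewrite a0 => /esym/eqP.
  by rewrite mulf_eq0 qE => /orP[/eqP ->|]; [rewrite mul0r|lia].
rewrite -(csum_arrow_pushK hs hs' xniep) (@csum_arrowE _ s' 0 0) /=.
- by rewrite ar subrr.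
- by rewrite a0.
- by rewrite ar; split=> //; exact: bpath_ge0.
Qed.

Lemma push_isotropy_surj e : arrow_r e = arrow_l e -> exists a,
  [/\ arrow_l a = homeo_inv h (arrow_l e), arrow_r a = arrow_l a &
      csum_arrow s a = arrow_int e].
Proof.
move=> er; have [uiep|uniep] := pselect (isolated_eventually_periodic (arrow_l e)).
  have xiep : isolated_eventually_periodic (homeo_inv h (arrow_l e)).
    by apply/iep_homeo; rewrite homeo_invK.
  have [_ pP] := periodP xiep.1; have [_ pP'] := periodP uiep.1.
  have [|q qE] := (pP' (arrow_int e)).1; first by rewrite -{2}er; exact: arrowP.
  have xq := (pP _).2 (ex_intro _ q erefl).
  by exists (Arrow xq); split=> //=; rewrite (hper (q := q)) //= homeo_invK.
have niep : ~ isolated_eventually_periodic (homeo_inv h (arrow_l e)).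
  by rewrite -iep_homeo homeo_invK.
exists (arrow_push hs' e); split=> //=; first by rewrite er.
exact: (@csum_arrow_pushK _ _ (homeo_sym h) s' s hs' hs).
Qed.

(** A morphism which is injective on objects is injective as soon as it is so on
    isotropy groups; likewise for surjectivity below, where orbits are hit
    because the inverse homeomorphism also has a cocycle. *)
Lemma push_inj : injective push.
Proof.
move=> a b ab.
have abl : arrow_l a = arrow_l b.
  exact: (can_inj (@homeo_funK _ _ h) (congr1 (@arrow_l F) ab)).
have abr : arrow_r a = arrow_r b.
  exact: (can_inj (@homeo_funK _ _ h) (congr1 (@arrow_r F) ab)).
have abi : csum_arrow s a = csum_arrow s b := congr1 (@arrow_int F) ab.
have abV : composable a (arrow_inv b) by [].
apply: arrow_ext => //; have := @push_isotropy_inj (arrow_mul abV).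
rewrite csum_arrow_mul csum_arrow_inv abi subrr /= abl => /(_ erefl erefl).
by lia.
Qed.

Lemma push_surj d : exists a, push a = d.
Proof.
pose b := arrow_push hs' d.
have pbl : arrow_l (push b) = arrow_l d by exact: homeo_invK.
have pbr : arrow_r (push b) = arrow_r d by exact: homeo_invK.
have dV : composable d (arrow_inv (push b)) by exact: esym pbr.
have [|c [cl cr cE]] := @push_isotropy_surj (arrow_mul dV); first exact: pbl.
have cb : composable c b by rewrite /composable cr cl.
exists (arrow_mul cb); apply: arrow_ext.
- by rewrite /= cl homeo_invK.
- by rewrite /= csum_arrow_mul cE /=; lia.
- exact: pbr.
Qed.

(** A continuous bijective morphism over a homeomorphism is open, since an
    arrow near a given one is determined by its left end. Hence near [d] the
    inverse is a local bisection through [psi d] applied to the transported left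
    end. *)
Lemma push_inv_continuous (psi : arrow F -> arrow E) :
  cancel push psi -> cancel psi push -> continuous psi.
Proof.
move=> pushK psiK d.
have [f [fa fc fl fi]] := local_bisection (psi d).
have [g [gd gc gl gi]] := local_bisection d.
pose theta e := f (homeo_inv h (arrow_l e)).
have lpsi : homeo_inv h (arrow_l d) = arrow_l (psi d).
  by rewrite -{1}(psiK d) /= homeo_funK.
have lc : {for d, continuous (homeo_inv h \o @arrow_l F)}.
  by apply: continuous_comp; [exact: arrow_l_continuous|exact: homeo_inv_continuous].
have thc : {for d, continuous theta}.
  by apply: continuous_comp => //=; rewrite lpsi.
have thd : theta d = psi d by rewrite /theta lpsi.
have pushth : {for d, continuous (push \o theta)}.
  exact: (continuous_comp thc
    (@arrow_push_continuous _ _ _ _ hs (@homeo_continuous _ _ h) (theta d))).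
have gi' : \forall e \near push (theta d), g (arrow_l e) = e.
  by rewrite thd psiK.
have lfl : \forall x \near homeo_inv h (arrow_l d), arrow_l (f x) = x.
  by rewrite lpsi.
have psith : \forall e \near d, psi e = theta e.
  have gth : \forall e \near d, g (arrow_l (push (theta e))) = push (theta e).
    exact: pushth gi'.
  have fl' : \forall e \near d, arrow_l (f (homeo_inv h (arrow_l e))) =
    homeo_inv h (arrow_l e) by exact: lc lfl.
  apply: filterS3 gth gi fl' => e /= gth ge fe.
  rewrite -[RHS]pushK; congr psi.
  by rewrite -[LHS]ge -[RHS]gth; congr g; rewrite [RHS]/= [in RHS]fe homeo_invK.
move=> A dA; have dA' : nbhs (theta d) A by rewrite thd.
by apply: filterS2 psith (thc _ dA') => e /= ->.
Qed.

Lemma push_groupoids_isomorphic : groupoids_isomorphic E F.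
Proof.
have /choice[psi psiK] := push_surj.
have pushK : cancel push psi by move=> a; apply: push_inj; rewrite psiK.
pose f := Homeo pushK psiK
  (@arrow_push_continuous _ _ _ _ hs (@homeo_continuous _ _ h))
  (push_inv_continuous pushK psiK).
have fM : groupoid_morphism f := arrow_push_morphism hs.
by exists f; split=> //; exact: groupoid_morphism_inv fM.
Qed.

End Reconstruction.

Lemma near_within_nat (X : topologicalType) (A : set X) (k : X -> nat) x :
  {within A, continuous k} -> A x -> nbhs x A -> \forall y \near x, k y = k x.
Proof.
move=> /subspace_continuousP kc Ax xA.
have kx : nbhs (k x) [set k x] by rewrite nbhs_principalE; exact/principal_filterP.
by apply: filterS2 xA (kc _ Ax _ kx) => y Ay; exact.
Qed.

Lemma within_nat_continuous (X : topologicalType) (A : set X) (k : X -> nat) :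
  (forall x, A x -> \forall y \near x, k y = k x) -> {within A, continuous k}.
Proof.
move=> kc; apply/subspace_continuousP => x Ax U /nbhs_singleton Uk.
apply: filterS (kc _ Ax) => y ky Ay.
by change (U (k y)); rewrite ky.
Qed.

Lemma orbit_cocycles_shift_cocycle (E F : digraph) (h : bpath E -> bpath F) k l :
  orbit_cocycles h k l -> shift_cocycle h (fun x => (l x)%:Z - (k x)%:Z)%R.
Proof.
move=> [kc lc hkl] x x1; exists (l x), (k x); have x1n := near_bpath_ge x1.
apply: filterS3 (near_within_nat kc x1 x1n) (near_within_nat lc x1 x1n) x1n.
by move=> y ky ly /hkl; rewrite ky ly => /shift_eq_sym.
Qed.

Lemma orbit_equivalence_groupoids_isomorphic (E F : digraph)
    (h : homeo (bpath E) (bpath F)) :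
  is_orbit_equivalence h -> preserves_isolated_eventually_periodic h ->
  groupoids_isomorphic E F.
Proof.
move=> [[k [l /orbit_cocycles_shift_cocycle hs]] [k' [l' hkl']]] hiep.
have hs' := orbit_cocycles_shift_cocycle hkl'.
have [|s [hs1 hper]] := corrected_cocycle hs.
  by move=> x /(iep_homeo hiep)[].
exact: (push_groupoids_isomorphic hs1 hs' hiep hper).
Qed.

(** * Locally constant choices *)

Section Selection.
Variable E : digraph.
Implicit Types (x y : bpath E).

Lemma cylinder_diff_clopen v s (r : seq (edge E)) x : is_path v s ->
  [set` r] `<=` out_edges (path_rng v s) ->
  \forall y \near x, cylinder_diff v s [set` r] y <-> cylinder_diff v s [set` r] x.
Proof.
move=> ps sr.
have : \forall y \near x, forall e, e \in r ->
    cylinder v (rcons s e) y <-> cylinder v (rcons s e) x.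
  apply: (@near_seq _ _ (nbhs x)) => e er; apply: cylinder_clopen.
  by rewrite -cats1 is_path_cat; split=> //; split=> //; exact: sr.
apply: filterS2 (cylinder_clopen x ps) => y ys yr.
split=> -[/ys zs zr]; split=> // -[e er ze]; apply: zr; exists e => //.
  exact/yr.
exact/yr.
Qed.

(** The topology has a countable basis of clopen sets. Enumerating it, [x] is
    given the value attached to the first basic set that contains [x] and is
    contained in some [P t]. Since membership in finitely many clopen sets is
    locally constant, so is the index of that set. *)
Lemma locally_constant_choice (T : Type) (t0 : T) (A : set (bpath E))
    (P : T -> bpath E -> Prop) :
  (forall x, A x -> exists t, \forall y \near x, P t y) ->
  exists f : bpath E -> T,
    forall x, A x -> P (f x) x /\ \forall y \near x, f y = f x.
Proof.
move=> AP; pose I : countType := (vert E * seq (edge E) * seq (edge E))%type.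
pose B (i : I) := cylinder_diff i.1.1 i.1.2 [set` i.2].
pose good (i : I) := [/\ is_path i.1.1 i.1.2,
  [set` i.2] `<=` out_edges (path_rng i.1.1 i.1.2) &
  exists t, forall y, B i y -> P t y].
have /choice[tau tauP] (i : I) : exists t, good i -> forall y, B i y -> P t y.
  have [[_ _ [t tP]]|ng] := pselect (good i); first by exists t.
  by exists t0.
pose G x (k : nat) := exists i : I, [/\ unpickle k = Some i, good i & B i x].
have /choice[N NP] x : exists n, (exists k, G x k) ->
    G x n /\ forall m, m < n -> ~ G x m.
  have [[k Gk]|nG] := pselect (exists k, G x k); last by exists 0.
  have ex : exists k, `[< G x k >] by exists k; apply/asboolP.
  case: (ex_minnP ex) => n /asboolP Gn nmin; exists n => _; split=> // m lt_mn.
  by move=> /asboolP/nmin; lia.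
exists (fun x => if unpickle (N x) is Some i then tau i else t0) => x Ax.
have Gx : exists k, G x k.
  have [t /nbhs_basisP[v [s [F [ps finF sF xB BP]]]]] := AP _ Ax.
  have /finite_seqP[r rE] := finF; subst F.
  exists (pickle ((v, s), r)), ((v, s), r); rewrite pickleK.
  by split=> //; split=> //; exists t.
have [GN Nmin] := NP _ Gx; split.
  by have [i [-> gi Bi]] := GN; exact: tauP.
have : \forall y \near x, forall m, m \in iota 0 (N x).+1 -> G y m <-> G x m.
  apply: (@near_seq _ _ (nbhs x)) => m _.
  have [[i [mi gi]]|nex] := pselect (exists i, unpickle m = Some i /\ good i).
    have [pi si _] := gi.
    apply: filterS (cylinder_diff_clopen x pi si) => y yx.
    split=> -[j [mj gj Bj]]; exists i; split=> //; apply/yx.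
      by move: Bj; rewrite mi in mj; case: mj => <-.
    by move: Bj; rewrite mi in mj; case: mj => <-.
  apply: (@nearW _ (nbhs x)) => y.
  by split=> -[j [mj gj _]]; case: nex; exists j.
apply: filterS => y yG; suff -> : N y = N x by [].
have mem m : m <= N x -> G y m <-> G x m.
  by move=> le_m; apply: yG; rewrite mem_iota; lia.
have Gy : G y (N x) by apply/mem.
have [GNy Nymin] := NP y (ex_intro _ _ Gy).
have [lt|lt|//] := ltngtP (N y) (N x).
  by case: (Nmin _ lt); apply/mem => //; exact: ltnW.
by case: (Nymin _ lt).
Qed.

End Selection.

(** * From isomorphism to orbit equivalence *)

Section IsoToOrbitEquivalence.
Variables E F : digraph.

Definition unit_arrow (G : digraph) (x : bpath G) : arrow G := Arrow (lag_refl x).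

Lemma unit_arrow_continuous (G : digraph) : continuous (@unit_arrow G).
Proof.
move=> x; apply: continuous_to_arrow; [exact: cvg_id|exact: cvg_id|].
exists 0, 0; apply: (@nearW _ (nbhs x)) => y /=.
by split=> //; split=> //; exact: bpath_ge0.
Qed.

Lemma groupoid_morphism_unit (f : arrow E -> arrow F) x : groupoid_morphism f ->
  f (unit_arrow x) = unit_arrow (arrow_l (f (unit_arrow x))).
Proof.
move=> [fM _]; have uu : composable (unit_arrow x) (unit_arrow x) by [].
have uuE : arrow_mul uu = unit_arrow x by apply: arrow_ext.
have [fuu] := fM _ _ uu; rewrite uuE => fE.
have int0 : arrow_int (f (unit_arrow x)) = 0%R.
  by have := congr1 (@arrow_int F) fE; rewrite /=; lia.
exact: arrow_ext.
Qed.

Lemma groupoid_morphism_l (f : arrow E -> arrow F) a : groupoid_morphism f ->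
  arrow_l (f a) = arrow_l (f (unit_arrow (arrow_l a))).
Proof.
move=> fM; have ua : composable (unit_arrow (arrow_l a)) a by [].
have [fua _] := fM.1 _ _ ua.
by rewrite -fua (groupoid_morphism_unit _ fM).
Qed.

Lemma groupoid_morphism_r (f : arrow E -> arrow F) a : groupoid_morphism f ->
  arrow_r (f a) = arrow_l (f (unit_arrow (arrow_r a))).
Proof.
move=> fM; have au : composable a (unit_arrow (arrow_r a)) by [].
by have [fau _] := fM.1 _ _ au.
Qed.

(** The map of unit spaces induced by [f]. *)
Definition unit_map (f : arrow E -> arrow F) x := arrow_l (f (unit_arrow x)).

Lemma unit_map_continuous f : continuous f -> continuous (unit_map f).
Proof.
move=> fc x.
exact: (continuous_comp (continuous_comp (@unit_arrow_continuous _ x) (fc _))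
  (@arrow_l_continuous _ _)).
Qed.

(** The image under [f] of the arrow from [x] to its shift has exponents valid
    near that arrow, and these are the cocycles; they are only locally defined
    and have to be chosen in a locally constant way. *)
Lemma unit_map_orbit_cocycles f : continuous f -> groupoid_morphism f ->
  exists k l, orbit_cocycles (unit_map f) k l.
Proof.
move=> fc fM.
have loc x : bpath_ge 1 x -> exists kl : nat * nat, \forall y \near x,
    shift_eq kl.1 (unit_map f (shift y)) kl.2 (unit_map f y).
  move=> x1; pose a : arrow E := Arrow (lag_shift x1).
  have [m [n mn]] := uniform_lag_comp (fc a) (uniform_lag_arrow (f a)).
  exists (n, m); apply: (near_arrow_l (a := a)).
  have a10 : shift_eq 1 (arrow_l a) 0 (arrow_r a).
    by split=> //; exact: bpath_ge0.
  apply: filterS2 mn (near_arrow a10 erefl) => b [_ fb] [_ [_ _ br]].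
  apply: shift_eq_sym; move: br fb => /= br.
  by rewrite (groupoid_morphism_l _ fM) (groupoid_morphism_r _ fM) -br.
have [kl klP] := locally_constant_choice (0, 0) loc.
exists (fst \o kl), (snd \o kl); split.
- by apply: within_nat_continuous => x /klP[_]; apply: filterS => y /= ->.
- by apply: within_nat_continuous => x /klP[_]; apply: filterS => y /= ->.
- by move=> x /klP[].
Qed.

End IsoToOrbitEquivalence.

Lemma unit_mapK (E F : digraph) (f : homeo (arrow E) (arrow F)) :
  groupoid_morphism f -> groupoid_morphism (homeo_inv f) ->
  cancel (unit_map f) (unit_map (homeo_inv f)).
Proof.
move=> fM gM x.
by rewrite {1}/unit_map -(groupoid_morphism_unit _ fM) homeo_funK.
Qed.

Lemma groupoids_isomorphic_orbit_equivalent (E F : digraph) :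
  groupoids_isomorphic E F -> orbit_equivalent E F.
Proof.
move=> [f [fM gM]].
have hK := unit_mapK fM gM.
have gK := @unit_mapK _ _ (homeo_sym f) gM fM.
pose h := Homeo hK gK (unit_map_continuous (@homeo_continuous _ _ f))
  (unit_map_continuous (@homeo_inv_continuous _ _ f)).
exists h; split.
  exact: unit_map_orbit_cocycles (@homeo_continuous _ _ f) fM.
exact: unit_map_orbit_cocycles (@homeo_inv_continuous _ _ f) gM.
Qed.

(** * Isolated points of graphs with recurrent infinite paths *)

Section Recurrence.
Variable E : digraph.
Implicit Types (x y : bpath E) (v : vert E).

(** The stabilisation of a graph with finitely many vertices has infinitely many,
    but this consequence of finiteness still holds for it. *)
Definition recurrent := forall w : nat -> edge E,
  (forall i, rng (w i) = src (w i.+1)) ->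
  forall n, exists i j, n <= i < j /\ src (w i) = src (w j).

Lemma recurrent_of_finite :
  (forall w : nat -> edge E, (forall i, rng (w i) = src (w i.+1)) ->
    exists S n, finite_set S /\ forall i, n <= i -> S (src (w i))) ->
  recurrent.
Proof.
move=> fin w wP n; have [S [m [/finite_seqP[r ->] wS]]] := fin _ wP.
pose t := [seq src (w (m + n + i)) | i <- iota 0 (size r).+1].
have : ~~ uniq t.
  have tr : {subset t <= r} by move=> _ /mapP[i _ ->]; apply: wS; lia.
  apply/negP => /uniq_leq_size/(_ tr).
  by rewrite size_map size_iota ltnn.
have v0 := src (w 0).
move=> /(uniqPn v0)[i [j [lt_ij]]]; rewrite size_map size_iota => lt_j tij.
exists (m + n + i), (m + n + j); split; first by lia.
move: tij; rewrite /t !(nth_map 0) ?size_iota ?nth_iota ?add0n //; lia.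
Qed.

Lemma path_from v : no_sinks E -> exists x : bpath E, prepath_src x = v.
Proof.
move=> ns; have /choice[nu nuP] u : exists e : edge E, src e = u.
  by have /eqP/set0P[e eu] := ns u; exists e.
pose w := fun i => iter i (fun e => nu (rng e)) (nu v).
have wP : is_boundary (Inf w) by move=> i; rewrite /w /= nuP.
by exists (BPath wP); exact: nuP.
Qed.

(** Without sinks, a finite boundary path ends at an infinite emitter, and it
    is the limit of its prolongations by the edges emitted there. Shifting to
    that vertex, which keeps the point isolated, avoids handling the
    prefix. *)
Lemma isolated_infinite x : no_sinks E -> open [set x] ->
  exists w, bpath_val x = Inf w.
Proof.
move=> ns ox; case xE : (bpath_val x) => [v s|w]; last by exists w.
have xs : bpath_ge (size s) x by rewrite /bpath_ge /= xE /=.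
pose t := iter (size s) shift x.
have t0 : prepath_onth t 0 = None.
  by rewrite onth_iter_shift xE /= onth_default ?addn0.
have tv : prepath_src t = path_rng v s.
  rewrite {xs t0}/t; elim: s v x xE {ox} => [|e s IH] v x xE; first by rewrite xE.
  by rewrite [size _]/= iterSr (IH (rng e)) //= xE.
have ot : open [set t].
  rewrite /t -[X in open X](image_set1 (iter (size s) shift)).
  by apply: open_iter_shift => // _ ->.
have : nbhs t [set t] by exact: open_nbhs_nbhs.
move=> /nbhs_basisP[u [r [F [pr finF rF [tr tF] Ft]]]].
have [rE uE] : r = [::] /\ u = path_rng v s.
  case: r tr pr {tF Ft rF} => [/cylinder0|e r tr pr].
    by rewrite tv.
  by have := cylinder_onth tr (ltn0Sn _); rewrite t0.
subst r u; have xP := bpathP x; rewrite xE /= in xP.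
have [_ [/ns //|inf]] := xP.
have [e [ve eF]] : exists e, out_edges (path_rng v s) e /\ ~ F e.
  apply: contra_notP inf => nex; apply: sub_finite_set finF => e ve.
  by apply: contra_notP nex => eF; exists e.
have [y' y'e] := path_from (rng e) ns.
have [y [_ y0]] := cons_boundary y'e.
suff yt : y = t by rewrite yt t0 in y0.
apply: Ft; split; first by apply/cylinder0; rewrite (src_head y0).
move=> [f Ff /cylinder_onth /(_ (ltn0Sn _))]; rewrite y0 => -[ef].
by apply: eF; rewrite ef.
Qed.

(** Along an isolated path no branching is possible from some position on, so
    two visits to the same vertex have the same continuation. *)
Lemma isolated_eventually_periodicE : no_sinks E -> recurrent ->
  @isolated_eventually_periodic E = [set x | open [set x]].
Proof.
move=> ns rec; apply/seteqP; split=> [x []//|x ox]; split=> //.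
have xinf := isolated_infinite ns ox; split=> //.
have [n0 n0P] := isolated_tail ox; have [w xw] := xinf.
have wP : forall i, rng (w i) = src (w i.+1) by have := bpathP x; rewrite xw.
have [i [j [/andP[le_i lt_ij] ij]]] := rec _ wP n0.
have xge n : bpath_ge n x by exact: bpath_ge_infinite.
have srcE n : prepath_src (iter n shift x) = src (w n).
  by apply: src_head; rewrite onth_iter_shift addn0 xw.
exists i, (j - i); split; first by lia.
rewrite subnKC; last exact: ltnW.
by split=> //; apply: n0P => //; rewrite !srcE.
Qed.

End Recurrence.

Lemma homeo_open_set1 (X Y : topologicalType) (h : homeo X Y) x :
  open [set x] -> open [set h x].
Proof.
move=> ox; have -> : [set h x] = homeo_inv h @^-1` [set x].
  apply/seteqP; split=> [_ ->|y /= <-] /=; [exact: homeo_funK|].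
  by rewrite homeo_invK.
by apply: open_comp => // y _; exact: homeo_inv_continuous.
Qed.

Lemma homeo_preserves_isolated_eventually_periodic (E F : digraph) (h : homeo (bpath E) (bpath F)) :
  no_sinks E -> recurrent E -> no_sinks F -> recurrent F ->
  preserves_isolated_eventually_periodic h.
Proof.
move=> nsE recE nsF recF; rewrite /preserves_isolated_eventually_periodic.
rewrite !isolated_eventually_periodicE //; apply/seteqP; split=> [_ [x ox <-]|y oy].
  exact: homeo_open_set1.
exists (homeo_inv h y); last exact: homeo_invK.
exact: (homeo_open_set1 (homeo_sym h)).
Qed.

Lemma groupoids_isomorphic_iff (E F : digraph) :
  (forall h : homeo (bpath E) (bpath F),
     preserves_isolated_eventually_periodic h) ->
  groupoids_isomorphic E F <-> orbit_equivalent E F.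
Proof.
move=> iep; split; first exact: groupoids_isomorphic_orbit_equivalent.
by move=> [h hoe]; exact: orbit_equivalence_groupoids_isomorphic hoe (iep h).
Qed.

Lemma finite_recurrent (E : digraph) : finitely_many_vertices E -> recurrent E.
Proof.
by move=> finE; apply: recurrent_of_finite => w _; exists setT, 0.
Qed.

Lemma stabilisation_no_sinks (E : digraph) : no_sinks E ->
  no_sinks (stabilisation E).
Proof.
move=> ns [v [|i]] sv.
  have /eqP/set0P[e ev] := ns v.
  have : @out_edges (stabilisation E) (v, 0) (inl e) by congr pair.
  by rewrite sv.
have : @out_edges (stabilisation E) (v, i.+1) (inr (v, i)) by [].
by rewrite sv.
Qed.

(** Each edge of a head lowers the level by one and the edges of [E] stay on
    level 0, so that an infinite path ends up in [E]. *)
Lemma stabilisation_recurrent (E : digraph) : finitely_many_vertices E ->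
  recurrent (stabilisation E).
Proof.
move=> finE; apply: recurrent_of_finite => w wP.
have level i : (src (w i)).2 = (src (w 0)).2 - i.
  elim: i => [|i IH]; first by rewrite subn0.
  rewrite -wP subnS -IH; case: (w i) => [e|[v j]] //.
exists [set (v, 0) | v in [set: vert E]], (src (w 0)).2; split.
  exact: finite_image.
move=> i le_i; exists (src (w i)).1 => //.
by rewrite [RHS]surjective_pairing level; congr pair; lia.
Qed.

Theorem corollary4p6 (E F : digraph)
    (finE : finitely_many_vertices E) (finF : finitely_many_vertices F)
    (nsE : no_sinks E) (nsF : no_sinks F) :
  (forall h : homeo (bpath E) (bpath F),
     preserves_isolated_eventually_periodic h) /\
  (forall h : homeo (bpath (stabilisation E)) (bpath (stabilisation F)),
     preserves_isolated_eventually_periodic h) /\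
  (groupoids_isomorphic E F <-> orbit_equivalent E F) /\
  (groupoids_isomorphic (stabilisation E) (stabilisation F) <->
     orbit_equivalent (stabilisation E) (stabilisation F)).
Proof.
have iep : forall h : homeo (bpath E) (bpath F),
    preserves_isolated_eventually_periodic h.
  by move=> h; apply: homeo_preserves_isolated_eventually_periodic => //; exact: finite_recurrent.
have iepS : forall h : homeo (bpath (stabilisation E)) (bpath (stabilisation F)),
    preserves_isolated_eventually_periodic h.
  move=> h; apply: homeo_preserves_isolated_eventually_periodic; first exact: stabilisation_no_sinks.
  - exact: stabilisation_recurrent.
  - exact: stabilisation_no_sinks.
  - exact: stabilisation_recurrent.
by split=> //; split=> //; split; exact: groupoids_isomorphic_iff.
Qed.
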